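(* Let $R$ be a commutative noetherian ring of prime characteristic $p>0$, and let $\mathfrak{a},I\subset R$ be ideals of positive height. Let $I$ be generated by $d$ elements and let $t\in\mathbb{R}_{>0}$. Then: (a) $\overline{I^{d+m}}^{\mathfrak{a}^t}\subset(I^{m+1})^{*\mathfrak{a}^t}$ for all integers $m\ge0$; and (b) $\overline{I^{d+m}}^{\mathfrak{a}^t}\subset(I^m)^{F\mathfrak{a}^t}$ for all integers $m\ge1$. Further, suppose $(R,\mathfrak{m})$ is local of dimension $\dim R=n$ and $R/\mathfrak{m}$ is infinite. Then: (c) $\overline{I^{n+m}}^{\mathfrak{a}^t}\subset(I^{m+1})^{*\mathfrak{a}^t}$ for all integers $m\ge0$; and (d) $\overline{I^{n+m}}^{\mathfrak{a}^t}\subset(I^m)^{F\mathfrak{a}^t}$ for all integers $m\ge1$.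
   Context: All rings are commutative with unit and noetherian. $R^\circ$ is the set of elements of $R$ not in any minimal prime of $R$. An ideal has positive height if it is not contained in any minimal prime. $J^{[p^e]}$ is the ideal generated by $\{r^{p^e}\mid r\in J\}$. For an ideal $J$: $$\overline{J}^{\mathfrak{a}^t}=\{x\in R\mid\text{for some }c\in R^\circ\text{ and all }n\gg0,\ cx^n\mathfrak{a}^{\lceil tn\rceil}\subset J^n\},$$ $$J^{*\mathfrak{a}^t}=\{x\in R\mid\text{for some }c\in R^\circ\text{ and all }e\gg0,\ cx^{p^e}\mathfrak{a}^{\lceil tp^e\rceil}\subset J^{[p^e]}\},$$ $$J^{F\mathfrak{a}^t}=\{x\in R\mid\text{for all }e\gg0,\ x^{p^e}\mathfrak{a}^{\lceil tp^e\rceil}\subset J^{[p^e]}\}.$$ Here $\overline{I^{d+m}}^{\mathfrak{a}^t}$ is $\overline{J}^{\mathfrak{a}^t}$ with $J=I^{d+m}$. *)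

(* Defs.v *)
From mathcomp Require Import all_boot all_order all_algebra.
From mathcomp Require Import all_classical all_reals.

Set Implicit Arguments.
Unset Strict Implicit.
Unset Printing Implicit Defensive.

Import Order.TTheory GRing.Theory Num.Theory.

Local Open Scope classical_set_scope.
Local Open Scope ring_scope.

Section Ideals.
Variable R : comNzRingType.
Implicit Types (I J P : set R) (S : set R).

(* The unit ideal is allowed, unlike with [idealr_closed] of ring_quotient,
   which only describes proper (and boolean) ideals. *)
Definition is_ideal I : Prop :=
  I 0 /\ forall a u v, I u -> I v -> I (a * u + v).

Definition ideal_gen S : set R := smallest is_ideal S.

Definition ideal_mul I J : set R := ideal_gen [set x * y | x in I & y in J].

(* The power of exponent 0 is the unit ideal. *)
Definition ideal_pow I (n : nat) : set R := iter n (ideal_mul I) [set: R].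

Definition frobenius_pow (p e : nat) J : set R :=
  ideal_gen [set r ^+ (p ^ e) | r in J].

Definition is_generated_by (d : nat) I : Prop :=
  exists f : 'I_d -> R, I = ideal_gen (range f).

Definition noetherian : Prop :=
  forall I, is_ideal I -> exists d : nat, is_generated_by d I.

Definition is_prime_ideal P : Prop :=
  [/\ is_ideal P, ~ P 1 & forall u v, P (u * v) -> P u \/ P v].

Definition is_minimal_prime P : Prop :=
  is_prime_ideal P /\ forall Q : set R, is_prime_ideal Q -> Q `<=` P -> Q = P.

Definition is_maximal_ideal I : Prop :=
  [/\ is_ideal I, ~ I 1
    & forall J, is_ideal J -> ~ J 1 -> I `<=` J -> J = I].

Definition is_local_with (mm : set R) : Prop :=
  is_maximal_ideal mm /\ forall J, is_maximal_ideal J -> J = mm.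

(* The carrier of R/I, as a set of subsets of R. *)
Definition quotient_set I : set (set R) := range (fun x : R => [set x + y | y in I]).

Definition is_prime_chain (k : nat) (P : 'I_k.+1 -> set R) : Prop :=
  (forall i, is_prime_ideal (P i)) /\
  (forall i j : 'I_k.+1, (i < j)%N -> P i `<` P j).

Definition has_krull_dim (n : nat) : Prop :=
  (exists P : 'I_n.+1 -> set R, is_prime_chain P) /\
  (forall (k : nat) (P : 'I_k.+1 -> set R), is_prime_chain P -> (k <= n)%N).

Definition positive_height I : Prop :=
  forall P, is_minimal_prime P -> ~ I `<=` P.

Definition ring_circ : set R := [set c | forall P, is_minimal_prime P -> ~ P c].

End Ideals.

Arguments noetherian : clear implicits.
Arguments has_krull_dim : clear implicits.
Arguments ring_circ : clear implicits.

Section Closures.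
Variables (R : comNzRingType) (K : realType).
Implicit Types (a J : set R) (t : K).

(* The absolute value only casts the ceiling from int to nat: it is used
   for t > 0, where the ceiling is nonnegative. *)
Definition ceil_mul t (n : nat) : nat := `|Num.ceil (t * n%:R)|%N.

Definition a_integral_closure a t J : set R :=
  [set x | exists2 c, ring_circ R c &
     exists N : nat, forall n : nat, (N <= n)%N ->
       [set c * x ^+ n * y | y in ideal_pow a (ceil_mul t n)]
         `<=` ideal_pow J n].

Definition a_tight_closure (p : nat) a t J : set R :=
  [set x | exists2 c, ring_circ R c &
     exists E : nat, forall e : nat, (E <= e)%N ->
       [set c * x ^+ (p ^ e) * y | y in ideal_pow a (ceil_mul t (p ^ e))]
         `<=` frobenius_pow p e J].

Definition a_frobenius_closure (p : nat) a t J : set R :=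
  [set x | exists E : nat, forall e : nat, (E <= e)%N ->
       [set x ^+ (p ^ e) * y | y in ideal_pow a (ceil_mul t (p ^ e))]
         `<=` frobenius_pow p e J].

End Closures.

(* Main.v *)
Require Import Defs.
From mathcomp Require Import all_boot all_order all_algebra.
From mathcomp Require Import all_classical all_reals.
From mathcomp Require Import -(notations) mpoly.
From mathcomp Require Import ring zify.
Import Order.TTheory GRing.Theory Num.Theory.
Local Open Scope classical_set_scope.
Local Open Scope ring_scope.

Set Implicit Arguments.
Unset Strict Implicit.
Unset Printing Implicit Defensive.

(** Write [q] for powers of [p]. If [I] has [d] generators, a monomial of
    degree [M] in them is the product of a [q]-th power of a monomial of degree
    [k] and of another monomial as soon as [M > d (q - 1) + (k - 1) q]
    ([pow_frobenius]). This gives (a) at once: the definition of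
    [x] being in the closure of [I^(d + m)], read for the exponent [q], says
    [c x^q a^⌈tq⌉ ⊂ I^((d + m) q)], and [(d + m) q > d (q - 1) + m q].

    For (b) the multiplier [c] has to disappear. The Artin-Rees lemma
    ([artin_rees], which rests on Hilbert's basis theorem) shows that [c z] in
    [I^N] implies [z = w + v] with [w] in [I^(N - k)] and [c v = 0], where [k]
    does not depend on [N]. As [c] avoids all minimal primes, [v] is nilpotent,
    and a fixed Frobenius power kills it. Hence [x^q a^⌈tq⌉ ⊂ I^((d + m) q - C)]
    with a constant [C] ([drop_multiplier]), and the condition on monomials
    leaves room for [C] when [I^m] replaces [I^(m+1)].

    For (c) and (d) one may assume [I] proper. It is enough to find an ideal
    [J] in [I] with [n = dim R] generators, or fewer, such that
    [I^(N + r) ⊂ J^N] for some [r] and all [N] ([reduction_exists]): in (d) the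
    shift by [r] is one more constant, in (c) it is absorbed by a multiplier
    in [I^r ∩ R°], which exists by prime avoidance ([pow_meets_circ]).

    Such a [J] is reached by removing generators one at a time. If more than
    [n] elements [y_j] of [mm] satisfy a form with a unit coefficient, then a
    linear change of variables, which exists as the residue field is infinite,
    makes the form monic in one variable, and the element at this
    place becomes superfluous up to a shift of exponents ([reduction_step]).

    There remains the existence of the form ([relation_exists]), which is the
    inequality between analytic spread and dimension. Parameters [x_1, ..., x_n]
    exhibit quotients [R / (x_1^N, ..., x_n^N)] of length at most [C N^n]
    ([colength_bound]), whereas there are more than [n] elements [y_j], hence
    too many monomials in them of degree at most a small fraction of [N]. So
    some form [F] with a unit coefficient has its value in [mm^N], where [N]
    exceeds any chosen multiple of [deg F]. If no form with a unit coefficient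
    vanished at [y], then [mm R[X]] would contain all relations, and Artin-Rees
    in [R[X]], applied to [y_0] and to the identity [y_0^i F = F(y) X_0^i]
    modulo relations, would yield [F] in [mm R[X]]. *)

(** * Ideals as sets *)

Lemma nsubset_ex T (A B : set T) : ~ A `<=` B -> exists2 z, A z & ~ B z.
Proof.
move=> nAB; apply: contrapT => noz; apply: nAB => z Az; apply: contrapT => nBz.
by apply: noz; exists z.
Qed.

Section IdealBasics.
Variable R : comNzRingType.
Implicit Types (A B E I J W : set R) (s : seq R).

Lemma ideal0 A : is_ideal A -> A 0.
Proof. by case. Qed.

Lemma idealMl A a u : is_ideal A -> A u -> A (a * u).
Proof. by move=> [A0 Al] Au; rewrite -[a * u]addr0; exact: Al. Qed.

Lemma idealMr A a u : is_ideal A -> A u -> A (u * a).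
Proof. by move=> iA Au; rewrite mulrC; exact: idealMl. Qed.

Lemma idealD A u v : is_ideal A -> A u -> A v -> A (u + v).
Proof. by move=> [_ Al] Au Av; rewrite -[u]mul1r; exact: Al. Qed.

Lemma idealN A u : is_ideal A -> A u -> A (- u).
Proof. by move=> iA Au; rewrite -mulN1r; exact: idealMl. Qed.

Lemma idealB A u v : is_ideal A -> A u -> A v -> A (u - v).
Proof. by move=> iA Au Av; apply: idealD => //; exact: idealN. Qed.

Lemma idealBl A u v : is_ideal A -> A (u - v) -> A v -> A u.
Proof. by move=> iA Auv Av; rewrite -(subrK v u); exact: idealD. Qed.

Lemma ideal_sum A (T : Type) (r : seq T) (P : pred T) (F : T -> R) :
  is_ideal A -> (forall i, P i -> A (F i)) -> A (\sum_(i <- r | P i) F i).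
Proof.
by move=> iA AF; elim/big_ind: _ => //; [exact: ideal0 | move=> *; exact: idealD].
Qed.

Lemma ideal_full A : is_ideal A -> A 1 -> A = setT.
Proof.
by move=> iA A1; apply/seteqP; split=> // z _; rewrite -[z]mulr1; exact: idealMl.
Qed.

Lemma is_idealT : is_ideal [set: R].
Proof. by []. Qed.

Lemma is_ideal00 : is_ideal [set 0 : R].
Proof. by split=> // a u v /= -> ->; rewrite mulr0 addr0. Qed.

Lemma ideal_colon A y : is_ideal A -> is_ideal [set x | A (x * y)].
Proof.
move=> iA; split; first by rewrite /= mul0r; exact: ideal0.
by move=> a u v /= Au Av; rewrite mulrDl -mulrA; case: iA => _; exact.
Qed.

Lemma ideal_setI A B : is_ideal A -> is_ideal B -> is_ideal (A `&` B).
Proof. by move=> [A0 Al] [B0 Bl]; split=> // a u v [Au Bu] [Av Bv]; split; auto. Qed.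

Lemma is_ideal_gen (S : set R) : is_ideal (ideal_gen S).
Proof.
split; first by move=> B [[]].
by move=> a u v Su Sv B [iB SB]; apply: iB.2; [exact: Su | exact: Sv].
Qed.

Lemma sub_ideal_gen (S : set R) : S `<=` ideal_gen S.
Proof. by move=> x Sx B [_]; exact. Qed.

Lemma ideal_gen_min (S : set R) A : is_ideal A -> S `<=` A -> ideal_gen S `<=` A.
Proof. by move=> iA SA x; apply; split. Qed.

Lemma ideal_gen_rangeP d (f : 'I_d -> R) z :
  ideal_gen (range f) z <-> exists c : 'I_d -> R, z = \sum_i c i * f i.
Proof.
split; last first.
  move=> [c ->]; apply: ideal_sum => [|i _]; first exact: is_ideal_gen.
  by apply: idealMl (is_ideal_gen _) _; apply: sub_ideal_gen; exists i.
apply: (@ideal_gen_min _ [set z | exists c : 'I_d -> R, z = \sum_i c i * f i]).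
  split; first by exists (fun=> 0); rewrite big1 // => i _; rewrite mul0r.
  move=> a u v [c ->] [c' ->]; exists (fun i => a * c i + c' i).
  by rewrite mulr_sumr -big_split; apply: eq_bigr => i _ /=; rewrite mulrDl mulrA.
move=> _ [i _ <-]; exists (fun j => (j == i)%:R).
rewrite (bigD1 i) //= eqxx mul1r big1 ?addr0 // => j /negbTE ->.
by rewrite mul0r.
Qed.

(** The ideal [(w) + E], in the form that suits inductions on a list of
    generators. *)
Definition adj (w : R) E : set R := [set z | exists a, E (z - a * w)].

Definition adjs W s : set R := foldr adj W s.

Lemma adj_ideal w E : is_ideal E -> is_ideal (adj w E).
Proof.
move=> iE; split; first by exists 0; rewrite mul0r subr0; exact: ideal0.
move=> a u v [b Eb] [c Ec]; exists (a * b + c).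
have -> : a * u + v - (a * b + c) * w = a * (u - b * w) + (v - c * w) by ring.
by case: iE => _; apply.
Qed.

Lemma adjs_ideal W s : is_ideal W -> is_ideal (adjs W s).
Proof. by move=> iW; elim: s => //= w s; exact: adj_ideal. Qed.

Lemma sub_adj w E : E `<=` adj w E.
Proof. by move=> z Ez; exists 0; rewrite mul0r subr0. Qed.

Lemma adj_in w E : is_ideal E -> adj w E w.
Proof. by move=> iE; exists 1; rewrite mul1r subrr; exact: ideal0. Qed.

Lemma adj_min w E A : is_ideal A -> E `<=` A -> A w -> adj w E `<=` A.
Proof.
by move=> iA EA Aw z [a /EA Az]; apply: idealBl Az _ => //; exact: idealMl.
Qed.

Lemma sub_adjs W s : W `<=` adjs W s.
Proof. by elim: s => //= w s IH z /IH; exact: sub_adj. Qed.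

Lemma adjs_in W s w : is_ideal W -> w \in s -> adjs W s w.
Proof.
move=> iW; elim: s => //= v s IH; rewrite inE => /predU1P[->|/IH].
  by apply: adj_in; exact: adjs_ideal.
exact: sub_adj.
Qed.

Lemma adjs_min W s A : is_ideal A -> W `<=` A -> (forall w, w \in s -> A w) ->
  adjs W s `<=` A.
Proof.
move=> iA WA; elim: s => //= w s IH As; apply: adj_min => //.
  by apply: IH => v sv; apply: As; rewrite inE sv orbT.
by apply: As; rewrite inE eqxx.
Qed.

Lemma adjs_subW W W' s : W `<=` W' -> adjs W s `<=` adjs W' s.
Proof. by move=> WW; elim: s => //= w s IH z [a /IH]; exists a. Qed.

Lemma adjs_cat W s s' : adjs W (s ++ s') = adjs (adjs W s') s.
Proof. by rewrite /adjs foldr_cat. Qed.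

(** * Powers of ideals *)

Lemma ideal_mul_ideal I J : is_ideal (ideal_mul I J).
Proof. exact: is_ideal_gen. Qed.

Lemma ideal_mul_in I J x y : I x -> J y -> ideal_mul I J (x * y).
Proof. by move=> Ix Jy; apply: sub_ideal_gen; exists x => //; exists y. Qed.

Lemma ideal_mul_min I J A : is_ideal A -> (forall x y, I x -> J y -> A (x * y)) ->
  ideal_mul I J `<=` A.
Proof. by move=> iA IJA; apply: ideal_gen_min => // _ [x Ix [y Jy <-]]; exact: IJA. Qed.

Lemma pow_ideal I n : is_ideal (ideal_pow I n).
Proof. by case: n => [|n]; [exact: is_idealT | exact: is_ideal_gen]. Qed.

Lemma powS I n : ideal_pow I n.+1 = ideal_mul I (ideal_pow I n).
Proof. by []. Qed.

Lemma pow1 I : is_ideal I -> ideal_pow I 1 = I.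
Proof.
move=> iI; apply/seteqP; split.
  by apply: ideal_mul_min => // x y Ix _; rewrite mulrC; exact: idealMl.
by move=> x Ix; rewrite -[x]mulr1; exact: ideal_mul_in.
Qed.

Lemma powD_in I m n x y :
  ideal_pow I m x -> ideal_pow I n y -> ideal_pow I (m + n) (x * y).
Proof.
elim: m x => [|m IH] x Ix Iy; first exact: idealMl (pow_ideal _ _) Iy.
rewrite addSn; apply: (ideal_mul_min (ideal_colon y (pow_ideal I _.+1)) _ Ix).
by move=> u v Iu Iv /=; rewrite -mulrA; apply: ideal_mul_in => //; exact: IH.
Qed.

Lemma powX_in I m k x : ideal_pow I m x -> ideal_pow I (m * k) (x ^+ k).
Proof.
move=> Ix; elim: k => [|k IH]; first by rewrite muln0.
by rewrite exprS mulnS; exact: powD_in.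
Qed.

Lemma pow_in I k x : is_ideal I -> I x -> ideal_pow I k (x ^+ k).
Proof. by move=> iI Ix; have := @powX_in I 1 k x; rewrite mul1n pow1 //; exact. Qed.

Lemma pow_sub I J n : I `<=` J -> ideal_pow I n `<=` ideal_pow J n.
Proof.
move=> IJ; elim: n => // n IH; rewrite powS.
apply: ideal_mul_min (ideal_mul_ideal _ _) _ => x y Ix Iy.
by apply: ideal_mul_in; [exact: IJ | exact: IH].
Qed.

Lemma pow_le I m n : (m <= n)%N -> ideal_pow I n `<=` ideal_pow I m.
Proof.
move=> /subnK <-; elim: (n - m)%N => // k IH.
rewrite addSn powS; apply: ideal_mul_min (pow_ideal _ _) _ => x y _ /IH.
exact: idealMl (pow_ideal _ _).
Qed.

Lemma powD_sub I m n :
  ideal_pow I (m + n) `<=` ideal_mul (ideal_pow I m) (ideal_pow I n).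
Proof.
elim: m => [|m IH]; first by move=> z Iz; rewrite -[z]mul1r; exact: ideal_mul_in.
rewrite addSn powS; apply: ideal_mul_min (ideal_mul_ideal _ _) _ => x y Ix /IH Iy.
rewrite mulrC; apply: (ideal_mul_min (ideal_colon x (ideal_mul_ideal _ _)) _ Iy).
move=> u v Iu Iv /=; rewrite mulrC mulrA.
by apply: ideal_mul_in => //; exact: ideal_mul_in.
Qed.

Lemma powM I m n : ideal_pow (ideal_pow I m) n = ideal_pow I (m * n).
Proof.
apply/seteqP; split.
  elim: n => [|n IH]; first by rewrite muln0.
  rewrite powS mulnS; apply: ideal_mul_min (pow_ideal _ _) _ => x y Ix /IH.
  exact: powD_in.
elim: n => [|n IH]; first by [].
rewrite mulnS => z /powD_sub; apply: ideal_mul_min (pow_ideal _ _) _ z => x y Ix /IH Iy.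
by rewrite powS; exact: ideal_mul_in.
Qed.

End IdealBasics.

(** * Noetherian rings *)

Section Noetherian.
Variable R : comNzRingType.
Implicit Types (A B E : set R).

Lemma adjs0_gen (s : seq R) : is_generated_by (size s) (adjs [set 0] s).
Proof.
exists (fun i : 'I_(size s) => s`_i); apply/seteqP; split; last first.
  apply: ideal_gen_min; first exact: adjs_ideal (@is_ideal00 _).
  by move=> _ [i _ <-]; apply: adjs_in (@is_ideal00 _) _; rewrite mem_nth.
apply: adjs_min => [|_ ->|w sw]; first exact: is_ideal_gen.
  exact: ideal0 (is_ideal_gen _).
apply: sub_ideal_gen; have ws : (index w s < size s)%N by rewrite index_mem.
by exists (Ordinal ws) => //=; rewrite nth_index.
Qed.

Lemma gen_adjs0 d (f : 'I_d -> R) : ideal_gen (range f) = adjs [set 0] (codom f).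
Proof.
apply/seteqP; split.
  apply: ideal_gen_min; first exact: adjs_ideal (@is_ideal00 _).
  by move=> _ [i _ <-]; apply: adjs_in (@is_ideal00 _) _; rewrite codom_f.
apply: adjs_min => [|_ ->|w /codomP[i ->]]; first exact: is_ideal_gen.
  exact: ideal0 (is_ideal_gen _).
by apply: sub_ideal_gen; exists i.
Qed.

Lemma noeth_adjs : noetherian R ->
  forall A, is_ideal A -> exists s, A = adjs [set 0] s.
Proof.
by move=> noeR A /noeR[d [f ->]]; exists (codom f); exact: gen_adjs0.
Qed.

Lemma adjs_noeth : (forall A, is_ideal A -> exists s, A = adjs [set 0] s) ->
  noetherian R.
Proof. by move=> H A /H[s ->]; exists (size s); exact: adjs0_gen. Qed.

Lemma chain_le (U : nat -> set R) : (forall n, U n `<=` U n.+1) ->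
  forall m n, (m <= n)%N -> U m `<=` U n.
Proof.
move=> Uinc m n /subnK <-; elim: (n - m)%N => // k IH x /IH.
by rewrite addSn; exact: Uinc.
Qed.

(** The union of an increasing chain is an ideal, and its finitely many
    generators all lie in one term. *)
Lemma noeth_acc (U : nat -> set R) : noetherian R ->
  (forall n, is_ideal (U n)) -> (forall n, U n `<=` U n.+1) ->
  exists N, U N.+1 `<=` U N.
Proof.
move=> noeR iU Uinc; have Ule := chain_le Uinc.
have /(noeth_adjs noeR)[s Us] : is_ideal (\bigcup_n U n).
  split; first by exists 0%N => //; exact: ideal0.
  move=> a u v [m _ Um] [n _ Un]; exists (maxn m n) => //.
  by apply: (iU _).2; [apply: Ule Um | apply: Ule Un]; lia.
have : forall w, w \in s -> (\bigcup_n U n) w.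
  by move=> w sw; rewrite Us; exact: adjs_in (@is_ideal00 _) sw.
move=> sU; suff [N sN] : exists N, forall w, w \in s -> U N w.
  exists N; apply: (@subset_trans _ (\bigcup_n U n)).
    by move=> x Ux; exists N.+1.
  by rewrite Us; apply: adjs_min => // _ ->; exact: ideal0.
elim: {Us}s sU => [|w s IH] sU; first by exists 0%N.
have [|N sN] := IH; first by move=> v sv; apply: sU; rewrite inE sv orbT.
have [|M _ Mw] := sU w; first by rewrite inE eqxx.
exists (maxn M N) => v; rewrite inE => /predU1P[->|/sN].
  by apply: Ule Mw; lia.
by apply: Ule; lia.
Qed.

(** Otherwise dependent choice builds a strictly increasing chain. *)
Lemma noeth_max (Phi : set (set R)) : noetherian R ->
  (forall A, Phi A -> is_ideal A) -> (exists A, Phi A) ->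
  exists2 A, Phi A & forall B, Phi B -> A `<=` B -> B `<=` A.
Proof.
move=> noeR iPhi [A0 PA0]; apply: contrapT => nomax.
have /choice[next nextP] : forall A, exists B, Phi A ->
    [/\ Phi B, A `<=` B & ~ B `<=` A].
  move=> A; have [PA|nPA] := EM (Phi A); last by exists A.
  apply: contrapT => noB; apply: nomax; exists A => // B PB AB.
  by apply: contrapT => nBA; apply: noB; exists B.
pose U n := iter n next A0.
have PU n : Phi (U n) by elim: n => // n /nextP[].
have [||N] := @noeth_acc U noeR; first by move=> n; exact: iPhi.
  by move=> n; have [] := nextP _ (PU n).
by have [] := nextP _ (PU N).
Qed.

Lemma noeth_ind (P : set R -> Prop) : noetherian R ->
  (forall A, is_ideal A ->
    (forall B, is_ideal B -> A `<=` B -> ~ B `<=` A -> P B) -> P A) ->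
  forall A, is_ideal A -> P A.
Proof.
move=> noeR IH A iA; apply: contrapT => nPA.
have [||B [iB nPB] maxB] := @noeth_max [set B | is_ideal B /\ ~ P B] noeR.
- by move=> B [].
- by exists A.
apply: nPB; apply: IH => // C iC BC nCB; apply: contrapT => nPC.
by apply: nCB; exact: maxB.
Qed.

End Noetherian.

Lemma adjs_image (A B : comNzRingType) (phi : {rmorphism A -> B}) (s : seq A) :
  phi @` adjs [set 0] s `<=` adjs [set 0] (map phi s).
Proof.
elim: s => [|w s IH] _ [z sz <-] /=; first by rewrite sz rmorph0.
case: sz => a sz; exists (phi a); apply: IH; exists (z - a * w) => //.
by rewrite rmorphB rmorphM.
Qed.

Lemma noeth_surj (A B : comNzRingType) (phi : {rmorphism A -> B}) :
  (forall b, exists a, phi a = b) -> noetherian A -> noetherian B.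
Proof.
move=> surj noeA; apply: adjs_noeth => E iE.
have /(noeth_adjs noeA)[s Es] : is_ideal (phi @^-1` E).
  split; first by rewrite /= rmorph0; exact: ideal0.
  by move=> a u v /= Eu Ev; rewrite rmorphD rmorphM; exact: iE.2.
exists (map phi s); apply/seteqP; split=> [b Eb|].
  have [a ab] := surj b; apply: adjs_image; exists a => //.
  by rewrite -Es /= ab.
apply: adjs_min => // [_ ->|w /mapP[a sa ->]]; first exact: ideal0.
suff: (phi @^-1` E) a by [].
by rewrite Es; exact: adjs_in (@is_ideal00 _) sa.
Qed.

Section HilbertBasis.
Variable R : comNzRingType.
Hypothesis noeR : noetherian R.

(** Multiplied by suitable powers of ['X], the polynomials of the list all get
    degree [D], and combining them then combines their leading coefficients. *)
Lemma adjs_lead (s : seq {poly R}) D a :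
  (forall f, f \in s -> 0 < size f <= D.+1)%N ->
  adjs [set 0] (map lead_coef s) a ->
  exists h : {poly R}, [/\ adjs [set 0] s h, (size h <= D.+1)%N & h`_D = a].
Proof.
elim: s a => [|f s IH] a sD /=.
  by move=> ->; exists 0; rewrite size_poly0 coef0.
case=> b sb; have [|h [sh hD hDa]] := IH _ _ sb.
  by move=> g sg; apply: sD; rewrite inE sg orbT.
have /andP[f_gt0 fD] := sD f (mem_head _ _).
exists (h + b *: 'X^(D.+1 - size f) * f); split.
- by exists (b *: 'X^(D.+1 - size f)); rewrite addrK.
- rewrite (leq_trans (size_polyD _ _)) // geq_max hD -scalerAl.
  rewrite (leq_trans (size_scale_leq _ _)) // mulrC size_mulXn ?subnK //.
  by rewrite -size_poly_gt0.
- rewrite coefD hDa -scalerAl coefZ coefXnM ifN; last by rewrite -leqNgt; lia.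
  have -> : (D - (D.+1 - size f) = (size f).-1)%N by lia.
  by rewrite -lead_coefE subrK.
Qed.

(** If an ideal is not generated by finitely many elements, choose in it
    successively an element of least degree outside the ideal generated by the
    earlier ones. A leading coefficient that is a combination of earlier ones
    would then yield an element of smaller degree outside that ideal. *)
Theorem hilbert_basis : noetherian {poly R}.
Proof.
apply: adjs_noeth => E iE; apply: contrapT => nfgE.
pose next_spec (s : seq {poly R}) g := (forall f, f \in s -> E f) ->
  [/\ E g, ~ adjs [set 0] s g &
      forall h, E h -> ~ adjs [set 0] s h -> (size g <= size h)%N].
have /choice[next nextP] : forall s, exists g, next_spec s g.
  move=> s; have [sE|nsE] := EM (forall f, f \in s -> E f); last by exists 0.
  have [h0 [Eh0 sh0]] : exists h, E h /\ ~ adjs [set 0] s h.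
    apply: contrapT => noh; apply: nfgE; exists s; apply/seteqP; split.
      by move=> h Eh; apply: contrapT => nsh; apply: noh; exists h.
    by apply: adjs_min => // _ ->; exact: ideal0.
  pose P n := `[< exists h, [/\ E h, ~ adjs [set 0] s h & size h = n] >].
  have exP : exists n, P n by exists (size h0); apply/asboolP; exists h0.
  case: (ex_minnP exP) => n /asboolP[g [Eg sg gn]] minn.
  exists g => _; split=> // h Eh sh; rewrite gn; apply: minn.
  by apply/asboolP; exists h.
pose hist n := iter n (fun s => next s :: s) [::].
pose f n := next (hist n).
have histE n : forall g, g \in hist n -> E g.
  elim: n => //= n IH g; rewrite inE => /predU1P[->|/IH //].
  by have [] := nextP _ IH.
have hist_size n : forall g, g \in hist n -> (0 < size g <= size (f n))%N.
  have hsub k : adjs [set 0] (hist k) `<=` adjs [set 0] (hist k.+1).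
    by move=> g; exact: sub_adj.
  elim: n => [//|n IH] g; rewrite [hist _]/= inE => /predU1P[->|/IH/andP[g0 gn]].
    have [En nn minn] := nextP _ (histE n).
    have [En' nn' _] := nextP _ (histE n.+1).
    apply/andP; split; last by apply: minn => // /hsub.
    rewrite lt0n size_poly_eq0; apply/eqP => f0; apply: nn; rewrite f0.
    by apply: ideal0; exact: adjs_ideal (@is_ideal00 _).
  have [En nn minn] := nextP _ (histE n).
  have [En' nn' _] := nextP _ (histE n.+1).
  by rewrite g0 (leq_trans gn) // minn // => /hsub.
pose L n := adjs [set 0] (map lead_coef (hist n)).
have [||N lead_in] := @noeth_acc _ L noeR.
- by move=> n; exact: adjs_ideal (@is_ideal00 _).
- by move=> n; exact: sub_adj.
have [En nn minn] := nextP _ (histE N).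
have : adjs [set 0] (map lead_coef (hist N)) (lead_coef (f N)).
  by apply: lead_in; rewrite /=; apply: adj_in; exact: adjs_ideal (@is_ideal00 _).
have fN_gt0 : (0 < size (f N))%N.
  by have /andP[] := hist_size N.+1 (f N) (mem_head _ _).
move=> /(adjs_lead (D := (size (f N)).-1))[|h [hh hD hlead]].
  by rewrite prednK //; exact: hist_size.
have Eh : E h.
  by move: hh; apply: adjs_min => // [_ ->|]; [exact: ideal0 | exact: histE].
have /minn : E (f N - h) by exact: idealB.
apply: contraPP; rewrite not_implyE => _; split.
  move=> nfh; apply: nn; apply: idealBl nfh hh.
  exact: adjs_ideal (@is_ideal00 _).
apply/negP; rewrite -ltnNge -(prednK fN_gt0) ltnS.
apply/leq_sizeP => j; rewrite leq_eqVlt => /predU1P[<-|fj].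
  by rewrite coefB hlead lead_coefE subrr.
rewrite coefB !nth_default ?subr0 //; last by rewrite -(prednK fN_gt0).
by rewrite (leq_trans hD).
Qed.

End HilbertBasis.

Lemma noeth_mpoly (R : comNzRingType) n : noetherian R -> noetherian (mpoly n R).
Proof.
move=> noeR; elim: n => [|n IH].
  apply: (@noeth_surj R _ (@mpolyC 0 R)) noeR => f.
  by exists (mcoeff mnm0 f); rewrite [RHS]nvar0_mpolyC.
have cX (a : mpoly n R) : GRing.comm (mpolyX R (mnm1 (@ord_max n))) (mwiden a).
  exact: mulrC.
pose phi : {rmorphism {poly mpoly n R} -> mpoly n.+1 R} := horner_morph cX.
apply: (@noeth_surj _ _ phi) (hilbert_basis IH) => f.
elim/mpolyind: f => [|c m f _ _ [b <-]]; first by exists 0; rewrite rmorph0.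
have [a <-] : exists a, phi a = mpolyX R m.
  rewrite mpolyXE_id; elim/big_ind: _ => [|x y [a <-] [a' <-]|i _].
  - by exists 1; rewrite rmorph1.
  - by exists (a * a'); rewrite rmorphM.
  - suff [a <-] : exists a, phi a = mpolyX R (mnm1 i).
      by exists (a ^+ m i); rewrite rmorphXn.
    have [j ->|->] := unliftP ord_max i; last by exists 'X; exact: horner_morphX.
    exists (mpolyX R (mnm1 j))%:P; rewrite [LHS]horner_morphC [LHS]mwidenX mnmwiden1.
    by congr (mpolyX R (mnm1 _)); apply/val_inj; rewrite /= /bump leqNgt ltn_ord.
exists ((mpolyC n c)%:P * a + b); rewrite rmorphD rmorphM /=.
by rewrite -mul_mpolyC; congr (_ * _ + _); rewrite [LHS]horner_morphC [LHS]mwidenC.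
Qed.

(** * Forms, the Rees algebra and the Artin-Rees lemma *)

Local Notation homog d := (ishomog1 d mdeg).

Section Forms.
Variables (R : comNzRingType) (d : nat).
Implicit Types (I J : set R) (v : 'I_d -> R) (F G : mpoly d R).

Lemma formP n F :
  reflect (forall m, m \in msupp F -> mdeg m = n) (F \is homog n).
Proof. exact: dhomogP. Qed.

Lemma mon_pow I v (m : multinom d) : is_ideal I -> (forall i, I (v i)) ->
  ideal_pow I (mdeg m) (\prod_i v i ^+ m i).
Proof.
move=> iI Iv; rewrite mdegE; elim/big_rec2: _ => // i y x _ Ix.
by apply: powD_in => //; exact: pow_in.
Qed.

Lemma pow_form v n z : ideal_pow (ideal_gen (range v)) n z ->
  exists2 F, F \is homog n & meval v F = z.
Proof.
elim: n z => [|n IH] z.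
  by exists (mpolyC d z); rewrite ?mevalC // -alg_mpolyC dhomogZ // dhomog1.
apply: (@ideal_mul_min _ _ _ [set z | exists2 F, F \is homog n.+1 & meval v F = z]).
  split; first by exists 0; rewrite ?meval0 // dhomog0.
  move=> a _ _ [F hF <-] [G hG <-]; exists (a *: F + G).
    by rewrite dhomogD // dhomogZ.
  by rewrite mevalD mevalZ.
move=> x y /ideal_gen_rangeP[c ->] /IH[F hF <-].
exists ((\sum_i c i *: mpolyX R (mnm1 i)) * F); last first.
  rewrite mevalM raddf_sum; congr (_ * _); apply: eq_bigr => i _ /=.
  by rewrite mevalZ mevalXU.
rewrite -add1n dhomogM // rpred_sum // => i _.
by rewrite dhomogZ // dhomogX /= mdeg1.
Qed.

(** The map [X_j |-> v_j T], whose image is the Rees algebra of the ideal of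
    the [v_j]; its kernel consists of the relations between the [v_j]. *)
Definition rees v : {rmorphism mpoly d R -> {poly R}} :=
  mmap (@polyC R) (fun i => v i *: 'X).

Lemma reesC v c : rees v (mpolyC d c) = c%:P.
Proof. exact: mmapC. Qed.

Lemma reesX v (m : multinom d) :
  rees v (mpolyX R m) = (\prod_i v i ^+ m i) *: 'X^(mdeg m).
Proof.
rewrite [LHS]mmapX mdegE /mmap1.
elim/big_rec3: _ => [|i x y z _ ->]; first by rewrite expr0 scale1r.
by rewrite exprZn -scalerAl -scalerAr scalerA exprD.
Qed.

Lemma reesE v F :
  rees v F = \sum_(m <- msupp F) (mcoeff m F * \prod_i v i ^+ m i) *: 'X^(mdeg m).
Proof.
rewrite {1}[F]mpolyE raddf_sum; apply: eq_bigr => m _ /=.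
by rewrite -mul_mpolyC rmorphM reesC reesX mul_polyC scalerA.
Qed.

Lemma rees_form v n F : F \is homog n -> rees v F = meval v F *: 'X^n.
Proof.
move=> /formP Fn; rewrite reesE mevalE scaler_suml big_seq [RHS]big_seq.
by apply: eq_bigr => m /Fn ->.
Qed.

Lemma rees_coef I v F k : is_ideal I -> (forall i, I (v i)) ->
  ideal_pow I k (rees v F)`_k.
Proof.
move=> iI Iv; rewrite reesE coef_sum; apply: ideal_sum => [|m _].
  exact: pow_ideal.
rewrite coefZ coefXn; have [->|_] := eqVneq; last first.
  by rewrite mulr0; apply: ideal0; exact: pow_ideal.
by rewrite mulr1; apply: idealMl (pow_ideal _ _) _; exact: mon_pow.
Qed.

End Forms.

Section ArtinRees.
Variable R : comNzRingType.
Implicit Types (I K : set R).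

(** Consider the polynomials whose image in the Rees algebra has coefficients
    in [c R + K]. They form a finitely generated ideal; let [k] bound the
    degrees of the images of its generators. In degree [N], a combination of
    generators only involves components of degree at least [N - k] of the
    coefficients. The ideal [K] makes this a statement on [R / K]. *)
Theorem artin_rees (I K : set R) c : noetherian R -> is_ideal I -> is_ideal K ->
  exists k, forall N z u, ideal_pow I N u -> K (c * z - u) ->
    exists2 w, ideal_pow I (N - k) w & K (c * (z - w)).
Proof.
move=> noeR iI iK; have [d [f If]] := noeR _ iI.
have fI i : I (f i) by rewrite If; apply: sub_ideal_gen; exists i.
pose C := adj c K; have iC : is_ideal C := adj_ideal c iK.
pose B := [set F : mpoly d R | forall i, C (rees f F)`_i].
have iB : is_ideal B.
  split=> [i|a u v Bu Bv i]; first by rewrite rmorph0 coef0; exact: ideal0.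
  rewrite rmorphD rmorphM coefD coefM; apply: idealD => //.
  by apply: ideal_sum => // j _; exact: idealMl.
have [bs Bbs] := noeth_adjs (@noeth_mpoly _ d noeR) iB.
pose k := (\max_(b <- bs) size (rees f b))%N.
exists k => N z u IuN Kzu.
suff [w Iw Kw] : exists2 w, ideal_pow I (N - k) w & K (u - c * w).
  exists w => //; have -> : c * (z - w) = (c * z - u) + (u - c * w) by ring.
  exact: idealD.
have [F hF Fu] : exists2 F, F \is homog N & meval f F = u.
  by apply: pow_form; rewrite -If.
have /(_ N) : forall i, exists2 w, ideal_pow I (i - k) w & K ((rees f F)`_i - c * w).
  have : adjs [set 0] bs F.
    rewrite -Bbs => i; rewrite (rees_form _ hF) coefZ; apply: idealMr => //.
    exists z; rewrite Fu; have -> : u - z * c = - (c * z - u) by ring.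
    exact: idealN.
  have : forall b, b \in bs -> B b /\ (size (rees f b) <= k)%N.
    move=> b bbs; split; last by exact: leq_bigmax_seq.
    by rewrite Bbs; exact: adjs_in (@is_ideal00 _) bbs.
  move: k F {hF Fu Bbs} => k; elim: bs => [|b bs IH] F bsB /=.
    move=> -> i; exists 0; first by apply: ideal0; exact: pow_ideal.
    by rewrite rmorph0 coef0 mulr0 subr0; exact: ideal0.
  move=> [a Fa] i; have [|w' Iw' Kw'] := IH _ _ Fa i.
    by move=> b' b'bs; apply: bsB; rewrite inE b'bs orbT.
  have [Bb bk] := bsB b (mem_head _ _).
  have /choice[t tP] : forall j, exists t, K ((rees f b)`_j - t * c) := Bb.
  pose t' j := if (j < k)%N then t j else 0.
  have tP' j : K ((rees f b)`_j - t' j * c).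
    rewrite /t'; case: ltnP => // kj.
    by rewrite nth_default ?mul0r ?subr0; [exact: ideal0 | exact: leq_trans kj].
  exists (\sum_(j < i.+1) (rees f a)`_(i - j) * t' j + w').
    apply: idealD => //; first exact: pow_ideal.
    apply: ideal_sum => [|j _]; first exact: pow_ideal.
    rewrite /t'; case: ltnP => [jk|_]; last first.
      by rewrite mulr0; apply: ideal0; exact: pow_ideal.
    apply: idealMr (pow_ideal _ _) _; apply: (@pow_le _ _ _ (i - j)); first lia.
    exact: rees_coef.
  have -> : (rees f F)`_i = (rees f a * rees f b)`_i + (rees f (F - a * b))`_i.
    by rewrite -rmorphM -coefD -rmorphD addrCA subrr addr0.
  rewrite mulrDr opprD addrACA; apply: idealD => //.
  rewrite coefMr mulr_sumr -sumrB; apply: ideal_sum => // j _.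
  have -> : (rees f a)`_(i - j) * (rees f b)`_j - c * ((rees f a)`_(i - j) * t' j) =
    (rees f a)`_(i - j) * ((rees f b)`_j - t' j * c) by ring.
  exact: idealMl.
by rewrite (rees_form _ hF) coefZ coefXn eqxx mulr1 Fu.
Qed.

End ArtinRees.

(** * Primes *)

Section Primes.
Variable R : comNzRingType.
Hypothesis noeR : noetherian R.
Implicit Types (I P Q : set R) (L : seq (set R)).

(** Noetherian induction: if [Q] is neither prime nor the unit ideal, then
    [u * v] lies in [Q] for some [u] and [v] outside [Q], and the lists of
    [Q + (u)] and [Q + (v)] together serve for [Q]. *)
Lemma prime_cover Q : is_ideal Q -> exists L,
  [/\ forall P, P \in L -> is_prime_ideal P /\ Q `<=` P,
      forall P, is_prime_ideal P -> Q `<=` P -> exists2 P', P' \in L & P' `<=` P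
    & forall w, (forall P, P \in L -> P w) -> exists k, Q (w ^+ k)].
Proof.
move: Q; apply: (noeth_ind noeR) => Q iQ IH.
have [Q1|nQ1] := EM (Q 1).
  exists [::]; split=> // [P [_ nP1 _] QP|w _]; last by exists 0%N.
  by case: nP1; exact: QP.
have [pQ|npQ] := EM (is_prime_ideal Q).
  exists [:: Q]; split=> [P|P _ QP|w wQ].
  - by rewrite inE => /eqP ->; split.
  - by exists Q => //; rewrite inE.
  - by exists 1%N; apply: wQ; rewrite inE.
have [u [v [Quv nQu nQv]]] : exists u v, [/\ Q (u * v), ~ Q u & ~ Q v].
  apply: contrapT => nouv; apply: npQ; split=> // u v Quv.
  apply: contrapT => /not_orP[nQu nQv]; apply: nouv; exists u, v.
  by split.
have grow w : ~ Q w -> exists L,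
  [/\ forall P, P \in L -> is_prime_ideal P /\ adj w Q `<=` P,
      forall P, is_prime_ideal P -> adj w Q `<=` P -> exists2 P', P' \in L & P' `<=` P
    & forall z, (forall P, P \in L -> P z) -> exists k, adj w Q (z ^+ k)].
  move=> nQw; apply: IH; [exact: adj_ideal | exact: sub_adj|].
  by move=> /(_ w (adj_in w iQ)).
have [L1 [L1p L1c L1n]] := grow u nQu; have [L2 [L2p L2c L2n]] := grow v nQv.
exists (L1 ++ L2); split=> [P|P pP QP|w wL].
- rewrite mem_cat => /orP[/L1p|/L2p] [pP QP]; split=> //.
    by apply: subset_trans QP; exact: sub_adj.
  by apply: subset_trans QP; exact: sub_adj.
- have [iP _ Pp] := pP; case: (Pp u v (QP _ Quv)) => [Pu|Pv].
    have [P' L1P' P'P] := L1c P pP (adj_min iP QP Pu).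
    by exists P' => //; rewrite mem_cat L1P'.
  have [P' L2P' P'P] := L2c P pP (adj_min iP QP Pv).
  by exists P' => //; rewrite mem_cat L2P' orbT.
- have [P PL1|k [a Qa]] := L1n w; first by apply: wL; rewrite mem_cat PL1.
  have [P PL2|l [b Qb]] := L2n w; first by apply: wL; rewrite mem_cat PL2 orbT.
  exists (k + l)%N; rewrite exprD.
  have -> : w ^+ k * w ^+ l = (w ^+ k - a * u) * w ^+ l +
      (a * u * (w ^+ l - b * v) + a * b * (u * v)) by ring.
  by apply: idealD => //; [exact: idealMr | apply: idealD => //; exact: idealMl].
Qed.

(** Descent in the finite list that covers [0]: a prime strictly below a member
    of the list contains another member. *)
Lemma min_prime_below P : is_prime_ideal P ->
  exists2 P', is_minimal_prime P' & P' `<=` P.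
Proof.
move=> pP; have [L [Lp Lc _]] := prime_cover (@is_ideal00 R).
have {Lc} : forall Q, is_prime_ideal Q -> Q `<=` P -> exists2 P', P' \in L & P' `<=` Q.
  by move=> Q pQ _; apply: Lc => // _ ->; apply: ideal0; case: pQ.
have {Lp} : forall Q, Q \in L -> is_prime_ideal Q by move=> Q /Lp[].
have [n] := ubnP (size L); elim: n => // n IH in L P pP *.
rewrite ltnS => Ln Lp Lc; have [P1 L1 P1P] := Lc P pP (@subset_refl _ P).
have [minP1|] := EM (is_minimal_prime P1); first by exists P1.
move=> /not_andP[/(_ (Lp _ L1))//|].
move=> /existsNP[Q /not_implyP[pQ /not_implyP[QP1 QneP1]]].
have [|Q' Q'L|Q' pQ' Q'Q|P' mP' P'Q] := IH (rem P1 L) Q pQ.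
- rewrite size_rem // (leq_trans _ Ln) // prednK //.
  by case: (L) L1.
- by apply: Lp; exact: mem_rem Q'L.
- have [P2 L2 P2Q'] := Lc Q' pQ' (subset_trans Q'Q (subset_trans QP1 P1P)).
  exists P2 => //; have := perm_to_rem L1 => /perm_mem /(_ P2).
  rewrite L2 inE => /esym/orP[/eqP P21|//].
  by case: QneP1; apply/seteqP; split=> //; rewrite -P21; exact: subset_trans P2Q' Q'Q.
by exists P' => //; exact: subset_trans P'Q (subset_trans QP1 P1P).
Qed.

Lemma min_prime_exists : exists P : set R, is_minimal_prime P.
Proof.
have [[|P L] [Lp _ Ln]] := prime_cover (@is_ideal00 R).
  have [//|k] := Ln 1; rewrite expr1n => /eqP.
  by rewrite oner_eq0.
have [pP _] := Lp P (mem_head _ _).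
by have [P' mP' _] := min_prime_below pP; exists P'.
Qed.

Lemma min_primes_finite :
  exists L, forall P, P \in L <-> is_minimal_prime P.
Proof.
have [L [Lp Lc _]] := prime_cover (@is_ideal00 R).
exists [seq P <- L | `[< is_minimal_prime P >]] => P; rewrite mem_filter.
split=> [/andP[/asboolP]//|mP]; apply/andP; split; first exact/asboolP.
have [[iP _ _] Pmin] := mP.
have [|P' LP' /Pmin <-//] := Lc P mP.1; first by move=> _ ->; exact: ideal0.
by have [] := Lp _ LP'.
Qed.

(** An element killed by some [c] in [R°] lies in every minimal prime. *)
Lemma circ_ann_nilp c w : ring_circ R c -> c * w = 0 -> exists k, w ^+ k = 0.
Proof.
move=> cR cw0; have [L [Lp Lc Ln]] := prime_cover (@is_ideal00 R).
apply: Ln => P /Lp[pP _]; have [P' mP' P'P] := min_prime_below pP.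
apply: P'P; have [[iP' _ P'p] _] := mP'.
by have [||//] := P'p c w; [rewrite cw0; exact: ideal0 | move/(cR _ mP')].
Qed.

Lemma prime_avoid_one P L : is_prime_ideal P ->
  (forall Q, Q \in L -> is_prime_ideal Q /\ ~ Q `<=` P) ->
  exists2 y, (forall Q, Q \in L -> Q y) & ~ P y.
Proof.
move=> [iP nP1 Pp]; elim: L => [|Q L IH] LP; first by exists 1.
have [|y Ly nPy] := IH; first by move=> Q' LQ'; apply: LP; rewrite inE LQ' orbT.
have [[iQ _ _] nQP] := LP Q (mem_head _ _).
have [z Qz nPz] : exists2 z, Q z & ~ P z by exact: nsubset_ex.
exists (z * y); last by move=> /Pp[].
move=> Q' LQ'; move: (LQ'); rewrite inE => /predU1P[->|LQ'']; first exact: idealMr.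
by apply: idealMl; [have [[]] := LP Q' LQ' | exact: Ly].
Qed.

(** A member [Q] of the list contained in the member [P] can be left out. If
    there is none for [P], an element of [I] and of all other members, but not
    of [P], corrects an element of [P] that avoids the others. *)
Lemma prime_avoidance I L : is_ideal I ->
  (forall P, P \in L -> is_prime_ideal P /\ ~ I `<=` P) ->
  exists2 x, I x & forall P, P \in L -> ~ P x.
Proof.
move=> iI; have [n] := ubnP (size L); elim: n => // n IH in L *.
case: L => [|P L] Ln LI; first by exists 0 => //; exact: ideal0.
have [[pP nIP] LI'] : (is_prime_ideal P /\ ~ I `<=` P) /\
    forall Q, Q \in L -> is_prime_ideal Q /\ ~ I `<=` Q.
  by split=> [|Q LQ]; apply: LI; rewrite inE ?eqxx // LQ orbT.
have [[Q LQ QP]|noQ] := EM (exists2 Q, Q \in L & Q `<=` P).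
  have [||x Ix xL] := IH (P :: rem Q L).
  - rewrite /= size_rem // prednK //; by case: (L) LQ.
  - by move=> Q'; rewrite inE => /predU1P[->//|/mem_rem/LI'].
  exists x => // Q'; rewrite inE => /predU1P[->|LQ'].
    by apply: xL; rewrite inE eqxx.
  have := perm_to_rem LQ => /perm_mem /(_ Q').
  rewrite LQ' inE => /esym/orP[/eqP ->|LQ'']; last by apply: xL; rewrite inE LQ'' orbT.
  by move=> /QP; apply: xL; rewrite inE eqxx.
have [//|//|x Ix xL] := IH L.
have [Px|nPx] := EM (P x); last first.
  by exists x => // Q; rewrite inE => /predU1P[->|/xL].
have [|y Ly nPy] := @prime_avoid_one P L pP.
  by move=> Q LQ; split; [have [] := LI' Q LQ | move=> QP; apply: noQ; exists Q].
have [z Iz nPz] : exists2 z, I z & ~ P z by exact: nsubset_ex.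
have [iP _ Pp] := pP.
exists (x + z * y); first by apply: idealD => //; exact: idealMr.
move=> Q; rewrite inE => /predU1P[-> Pxzy|LQ Qxzy].
  have /Pp[] // : P (z * y) by rewrite -[z * y](addKr x) addrC; exact: idealB.
have [[iQ _ _] _] := LI' Q LQ.
apply: (xL _ LQ); rewrite -(addrK (z * y) x); apply: idealB => //.
by apply: idealMl => //; exact: Ly.
Qed.

Lemma circM c c' : ring_circ R c -> ring_circ R c' -> ring_circ R (c * c').
Proof.
by move=> cR cR' P mP; have [[_ _ Pp] _] := mP => /Pp[/(cR _ mP)|/(cR' _ mP)].
Qed.

Lemma circ1 : ring_circ R 1.
Proof. by move=> P [[]]. Qed.

Lemma pow_meets_circ I r : is_ideal I -> positive_height I ->
  exists2 c, ring_circ R c & ideal_pow I r c.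
Proof.
move=> iI hI; have [L LP] := min_primes_finite.
have [P /LP mP|x Ix xL] := @prime_avoidance I L iI.
  by split; [case: mP | exact: hI].
have xR : ring_circ R x by move=> P /LP; exact: xL.
exists (x ^+ r); last exact: pow_in.
by elim: r => [|r IH]; [exact: circ1 | rewrite exprS; exact: circM].
Qed.

End Primes.

(** * Frobenius powers and removal of the multiplier *)

Section FrobeniusPowers.
Variable R : comNzRingType.
Implicit Types (I J : set R).

(** Division of exponents by [q = p ^ e] writes a monomial of degree [M] as the
    [q]-th power of a monomial times a monomial of degree at most [s (q - 1)],
    so the former has degree at least [k]. *)
Lemma pow_frobenius p e I s (f : 'I_s -> R) k M : (0 < p)%N ->
  I = ideal_gen (range f) ->
  (s * (p ^ e).-1 + k * p ^ e < M + p ^ e)%N ->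
  ideal_pow I M `<=` frobenius_pow p e (ideal_pow I k).
Proof.
move=> p_gt0 If; set q := (p ^ e)%N => Mbig.
have q_gt0 : (0 < q)%N by rewrite expn_gt0 p_gt0.
have iI : is_ideal I by rewrite If; exact: is_ideal_gen.
rewrite {1}If => z /pow_form[F /formP hF <-]; rewrite mevalE big_seq.
apply: ideal_sum => [|m /hF mM]; first exact: is_ideal_gen.
apply: (idealMl _ (is_ideal_gen _)).
have -> : \prod_i f i ^+ m i =
    (\prod_i f i ^+ (m i %% q)) * (\prod_i f i ^+ (m i %/ q)) ^+ q.
  rewrite -prodrXl -big_split; apply: eq_bigr => i _ /=.
  by rewrite -exprM -exprD {1}(divn_eq (m i) q) addnC.
apply: (idealMl _ (is_ideal_gen _)).
apply: sub_ideal_gen; exists (\prod_i f i ^+ (m i %/ q)) => //.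
apply: (@pow_le _ _ _ (\sum_(i < s) m i %/ q)%N).
  have : (M <= q * (\sum_(i < s) m i %/ q) + s * q.-1)%N.
    have -> : (s * q.-1 = \sum_(i < s) q.-1)%N by rewrite sum_nat_const card_ord.
    rewrite -mM mdegE big_distrr /= -big_split /=.
    apply: leq_sum => i _; rewrite {1}(divn_eq (m i) q) mulnC leq_add2l.
    by rewrite -ltnS prednK // ltn_pmod.
  move: Mbig; set S := (\sum_(i < s) _)%N; case: leqP => // Sk; nia.
have fI i : I (f i) by rewrite If; apply: sub_ideal_gen; exists i.
elim/big_rec2: _ => // i y x _ Ix; apply: powD_in => //; exact: pow_in.
Qed.

Lemma frobenius_pow_sub p e I J : I `<=` J ->
  frobenius_pow p e I `<=` frobenius_pow p e J.
Proof.
move=> IJ; apply: ideal_gen_min; first exact: is_ideal_gen.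
by move=> _ [r Ir <-]; apply: sub_ideal_gen; exists r => //; exact: IJ.
Qed.

Lemma frobenius_powT p e z : frobenius_pow p e [set: R] z.
Proof.
rewrite -[z]mulr1; apply: (idealMl _ (is_ideal_gen _)).
by apply: sub_ideal_gen; exists 1; rewrite ?expr1n.
Qed.

Lemma pchar_exp p e : p \in [pchar R] -> [pchar R].-nat (p ^ e)%N.
Proof. by move=> charR; rewrite pnatX pnatE ?charR ?orbT // (pcharf_prime charR). Qed.

(** Nilpotent elements of a finitely generated ideal have nilpotency
    exponents that are bounded, and powers of [p] are additive. *)
Lemma nil_exponent p J : noetherian R -> p \in [pchar R] -> is_ideal J ->
  (forall w, J w -> exists k, w ^+ k = 0) ->
  exists e, forall w, J w -> w ^+ (p ^ e) = 0.
Proof.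
move=> noeR charR iJ Jnil; have [s Js] := noeth_adjs noeR iJ.
have p_gt1 : (1 < p)%N by exact: prime_gt1 (pcharf_prime charR).
have : forall w, w \in s -> exists k, w ^+ k = 0.
  by move=> w sw; apply: Jnil; rewrite Js; exact: adjs_in (@is_ideal00 _) sw.
have le0 (w : R) k l : (k <= l)%N -> w ^+ k = 0 -> w ^+ l = 0.
  by move=> /subnK <- wk; rewrite exprD wk mulr0.
rewrite Js; elim: {Js}s => [|w s IH] snil /=.
  by exists 0%N => _ ->; rewrite expr0n.
have [|e se] := IH; first by move=> v sv; apply: snil; rewrite inE sv orbT.
have [k wk] := snil w (mem_head _ _).
exists (e + k)%N => z [a /se za]; rewrite -(subrK (a * w) z).
rewrite exprDn_pchar ?pchar_exp // exprMn [w ^+ _](le0 _ k) ?mulr0 ?addr0 //.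
  by rewrite (le0 _ (p ^ e)%N) // leq_exp2l // leq_addr.
by rewrite (leq_trans (ltnW (ltn_expl k p_gt1))) // leq_exp2l // leq_addl.
Qed.

End FrobeniusPowers.

Section DropMultiplier.
Variables (R : comNzRingType) (K : realType).
Implicit Types (a I J : set R) (t : K).

Lemma ceil_mul_itv t n : 0 < t ->
  t * n%:R <= (ceil_mul t n)%:R /\ (ceil_mul t n)%:R < t * n%:R + 1.
Proof.
move=> t0; have tn0 : 0 <= t * n%:R by rewrite mulr_ge0 // ltW.
have c0 : 0 <= Num.ceil (t * n%:R) by rewrite ceil_ge0 (lt_le_trans _ tn0) // ltrN10.
have -> : (ceil_mul t n)%:R = (Num.ceil (t * n%:R))%:~R :> K.
  by rewrite /ceil_mul natr_absz ger0_norm.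
by have := ceil_itv (t * n%:R); rewrite intrB ltrBlDr => /andP[].
Qed.

(** The Artin-Rees lemma for [c] gives [x^n y = w + v] where [w] lies in
    [I^(D n - k)] and [c v = 0]. As [v] is nilpotent, a power [q0] of [p]
    kills it, and [(x^n y)^q0 = w^q0] no longer involves [c]. Finally
    [a^⌈t q⌉] is contained in the [q0]-th Frobenius power of [a^⌈t n⌉] if [n]
    is smaller than [q / q0] by a constant. *)
Theorem drop_multiplier p a I t D x : noetherian R -> p \in [pchar R] ->
  is_ideal a -> is_ideal I -> 0 < t ->
  a_integral_closure a t (ideal_pow I D) x ->
  exists C E, forall e, (E <= e)%N ->
    forall y, ideal_pow a (ceil_mul t (p ^ e)) y ->
      ideal_pow I (D * p ^ e - C) (x ^+ (p ^ e) * y).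
Proof.
move=> noeR charR ia iI t0 [c cR [N0 xN0]].
have p_gt1 : (1 < p)%N by exact: prime_gt1 (pcharf_prime charR).
have p_gt0 := ltnW p_gt1.
have [k ARk] := artin_rees c noeR iI (@is_ideal00 R).
have [e0 nil0] : exists e0, forall w, c * w = 0 -> w ^+ (p ^ e0) = 0.
  apply: (@nil_exponent _ p [set w | c * w = 0]) => //.
    split; first by rewrite /= mulr0.
    by move=> b u v /= cu cv; rewrite mulrDr mulrCA cu cv mulr0 addr0.
  by move=> w /(circ_ann_nilp noeR cR).
have [r [g ag]] := noeR _ ia.
have [delta rdelta] : exists delta : nat, r%:R <= t * delta%:R.
  exists (Num.truncn (r%:R / t)).+1.
  by rewrite mulrC -ler_pdivrMr // ltW // truncnS_gt.
set q0 := (p ^ e0)%N in nil0; have q0_gt0 : (0 < q0)%N by rewrite expn_gt0 p_gt0.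
exists ((D * delta + k) * q0)%N, (e0 + (N0 + delta))%N => e Ee y ay.
have [e1 ee1] : exists e1, e = (e0 + e1)%N by exists (e - e0)%N; lia.
set q1 := (p ^ e1)%N; have qE : (p ^ e = q0 * q1)%N by rewrite ee1 expnD.
have q1big : (N0 + delta <= q1)%N.
  by apply: leq_trans (ltnW (ltn_expl e1 p_gt1)); lia.
(* Working below [q1] by [delta >= r / t] makes up for the at most [r (q0 - 1)]
   factors lost when a monomial in [r] generators is divided by [q0]. *)
pose n := (q1 - delta)%N; have nE : (n + delta = q1)%N by rewrite /n; lia.
have {ay} : frobenius_pow p e0 (ideal_pow a (ceil_mul t n)) y.
  apply: (pow_frobenius p_gt0 ag _ ay); rewrite -/q0.
  have [_ bn] := ceil_mul_itv n t0; have [bq _] := ceil_mul_itv (p ^ e) t0.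
  rewrite -(ltr_nat K) !natrD !natrM.
  have q0R : 0 < q0%:R :> K by rewrite ltr0n.
  apply: (@le_lt_trans _ _ (r%:R * q0%:R + (ceil_mul t n)%:R * q0%:R)).
    by rewrite lerD2r ler_wpM2l ?ler0n // ler_nat leq_pred.
  apply: (@lt_le_trans _ _ (t * delta%:R * q0%:R + (t * n%:R + 1) * q0%:R)).
    by rewrite ler_ltD // ?ler_pM2r // ltr_pM2r.
  rewrite mulrDl mul1r addrA lerD2r (le_trans _ bq) //.
  by rewrite -mulrDl -mulrDr -natrD addnC nE qE natrM mulrA mulrAC.
have keyI : (D * p ^ e - (D * delta + k) * q0 <= (D * n - k) * q0)%N.
  rewrite qE -nE; nia.
move: y; apply: (@ideal_gen_min _ _ [set y | ideal_pow I _ (x ^+ (p ^ e) * y)]).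
  split; first by rewrite /= mulr0; apply: ideal0; exact: pow_ideal.
  move=> b u v /= Iu Iv; rewrite mulrDr mulrCA.
  by apply: (pow_ideal _ _).2.
move=> _ [y ay <-] /=; apply: (pow_le keyI).
have -> : x ^+ (p ^ e) * y ^+ q0 = x ^+ (delta * q0) * (x ^+ n * y) ^+ q0.
  by rewrite exprMn mulrA -exprM -exprD -mulnDl addnC nE mulnC qE.
apply: idealMl; first exact: pow_ideal.
have [||w Iw /= cw] := ARk (D * n)%N (x ^+ n * y) (c * (x ^+ n * y)).
- rewrite -powM mulrA; apply: (xN0 n); first by lia.
  by exists y.
- by rewrite /= subrr.
have := nil0 _ cw; move: (x ^+ n * y) => z zw0.
have -> : z ^+ q0 = w ^+ q0.
  by rewrite -{1}(subrK w z) exprDn_pchar ?pchar_exp // zw0 add0r.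
exact: powX_in.
Qed.

End DropMultiplier.

(** * Lengths and parameters in a local ring *)

Section Local.
Variables (R : comNzRingType) (mm : set R).
Hypotheses (noeR : noetherian R) (localR : is_local_with mm).
Implicit Types (D E Q W : set R) (s xs : seq R).

Lemma max_ideal : is_ideal mm.
Proof. by have [[]] := localR. Qed.
Let imm := max_ideal.

Lemma max_proper : ~ mm 1.
Proof. by have [[]] := localR. Qed.

Lemma proper_sub_max E : is_ideal E -> ~ E 1 -> E `<=` mm.
Proof.
move=> iE nE1.
pose Phi A := [/\ is_ideal A, ~ A 1 & E `<=` A].
have [||A [iA nA1 EA] maxA] := @noeth_max _ [set A | Phi A] noeR.
- by move=> A [].
- by exists E; split.
suff <- : A = mm by [].
apply: localR.2; split=> // J iJ nJ1 AJ; apply/seteqP; split=> //.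
by apply: maxA => //; split=> //; exact: subset_trans AJ.
Qed.

Lemma local_unit u : ~ mm u -> exists v, v * u = 1.
Proof.
move=> nmu; apply: contrapT => nov; apply: nmu.
apply: (@proper_sub_max (adj u [set 0])); last exact: adj_in (@is_ideal00 _).
  exact: adj_ideal (@is_ideal00 _).
by move=> [a /= /subr0_eq a1]; apply: nov; exists a.
Qed.

Lemma prime_sub_max P : is_prime_ideal P -> P `<=` mm.
Proof. by move=> [iP nP1 _]; exact: proper_sub_max. Qed.

Lemma max_prime : is_prime_ideal mm.
Proof.
split=> //; first exact: max_proper.
move=> u v muv; have [mu|/local_unit[u' u'u]] := EM (mm u); [by left | right].
by rewrite -[v]mul1r -u'u -mulrA; exact: idealMl.
Qed.

(** The length of [E / W] is at most [size s] if [E = adjs W s] and [compser W s],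
    as [s] exhibits a filtration with quotients that [mm] annihilates and
    that are generated by one element. *)
Fixpoint compser W s : Prop :=
  if s is h :: s' then (forall z, mm z -> adjs W s' (z * h)) /\ compser W s'
  else True.

(** For an ideal [E] between [W] and [adjs W s] this is the number of steps of
    the filtration where [E] contributes, that is, the length of [E / W]. *)
Fixpoint len W s E : nat :=
  if s is h :: s' then ~~ `[< E `<=` adjs W s' >] + len W s' (E `&` adjs W s')
  else 0.

Lemma len_le W s E : (len W s E <= size s)%N.
Proof. by elim: s E => //= h s IH E; rewrite -add1n leq_add // leq_b1. Qed.

Lemma len_mono W s E E' : E `<=` E' -> (len W s E <= len W s E')%N.
Proof.
elim: s E E' => //= h s IH E E' EE'; rewrite leq_add //; last first.
  by apply: IH => z [/EE']; split.
case: asboolP => //= nE; case: asboolP => // E's.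
by case: nE; exact: subset_trans E's.
Qed.

(** In a step of the filtration where both ideals contribute, the quotient is
    a line over the residue field, so elements of [E'] agree with elements
    of [E] up to the next step. *)
Lemma len_eq W s E E' : is_ideal W -> compser W s ->
  is_ideal E -> is_ideal E' -> W `<=` E -> E `<=` E' -> E' `<=` adjs W s ->
  (len W s E' <= len W s E)%N -> E' `<=` E.
Proof.
move=> iW; elim: s E E' => [|h s IH] /= E E' cs iE iE' WE EE' E's lenE.
  exact: subset_trans WE.
have [mh {}cs] := cs; set A := adjs W s in IH mh E's lenE *.
have iA : is_ideal A by exact: adjs_ideal.
have EE'A : E `&` A `<=` E' `&` A by move=> z [/EE']; split.
have lenA := len_mono W s EE'A.
have E'EA : E' `&` A `<=` E `&` A.
  apply: (IH (E `&` A) (E' `&` A) cs) => //; try exact: ideal_setI.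
  - by move=> z Wz; split; [exact: WE | exact: sub_adjs].
  - move: lenE; case: asboolP => //= E'A; case: asboolP => //= EA; try lia.
    by case: EA; exact: subset_trans EE' E'A.
have [E'A|nE'A] := EM (E' `<=` A).
  by move=> z E'z; have [] := E'EA z (conj E'z (E'A z E'z)).
have nEA : ~ E `<=` A.
  move=> EA; move: lenE; case: asboolP => //= _; case: asboolP => //= _.
  by move: (len_mono W s E'EA) lenA; lia.
have [z' Ez' nAz'] : exists2 z', E z' & ~ A z' by exact: nsubset_ex.
have [b Ab] := E's _ (EE' _ Ez').
have [b' b'b] : exists b', b' * b = 1.
  apply: local_unit => mb; apply: nAz'; apply: idealBl Ab _ => //; exact: mh.
move=> z E'z; have [a Aa] := E's _ E'z.
apply: (@idealBl _ E _ (a * b' * z')) => //; last exact: idealMl.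
suff /E'EA[] : (E' `&` A) (z - a * b' * z') by []; split.
  by apply: idealB => //; apply: idealMl => //; exact: EE'.
have -> : z - a * b' * z' = (z - a * h) - a * b' * (z' - b * h) - a * (b' * b - 1) * h.
  by ring.
by rewrite b'b subrr mulr0 mul0r subr0; apply: idealB => //; exact: idealMl.
Qed.

(** Each strict inclusion lowers [len], which cannot exceed [size s]. *)
Lemma chain_pigeonhole W s (D : nat -> set R) r : is_ideal W -> compser W s ->
  [set: R] = adjs W s -> (forall j, is_ideal (D j)) -> (forall j, W `<=` D j) ->
  (forall j, D j.+1 `<=` D j) -> (size s < r)%N ->
  exists2 j, (j < r)%N & D j `<=` D j.+1.
Proof.
move=> iW cs sT iD WD Ddec sr; apply: contrapT => nostat.
have : forall j, (j <= r)%N -> (len W s (D j) + j <= size s)%N.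
  elim=> [_|j IH jr]; first by rewrite addn0 len_le.
  have := IH (ltnW jr); suff : (len W s (D j.+1) < len W s (D j))%N by lia.
  rewrite ltnNge; apply/negP => lenj; apply: nostat; exists j => //.
  by apply: len_eq lenj => //; rewrite -sT.
by move=> /(_ r (leqnn r)); lia.
Qed.

Definition colength_le W L : Prop := exists s,
  [/\ (size s <= L)%N, compser W s & [set: R] = adjs W s].

Lemma compser_cat W s s' :
  compser W s' -> compser (adjs W s') s -> compser W (s ++ s').
Proof.
move=> cs'; elim: s => //= h s IH [mh /IH cs]; split=> // z /mh.
by rewrite adjs_cat.
Qed.

(** Multiplication by [x] maps a filtration of [R / W0] to one of
    [((x) + W) / W]. *)
Lemma compser_mul W0 W x s : is_ideal W0 -> is_ideal W ->
  (forall w, W0 w -> W (x * w)) -> compser W0 s ->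
  compser W (map ( *%R x) s) /\
  forall w, adjs W0 s w -> adjs W (map ( *%R x) s) (x * w).
Proof.
move=> iW0 iW xW; elim: s => [|h s IH] //= [mh /IH[cs sub]]; split.
  by split=> // z /mh /sub; rewrite mulrCA.
by move=> w [a /sub]; exists a; rewrite mulrCA -mulrBr.
Qed.

Lemma adj_adjs W w s : is_ideal W -> adj w (adjs W s) = adjs (adj w W) s.
Proof.
move=> iW; have iw := adj_ideal w iW; apply/seteqP; split.
  apply: adj_min; first exact: adjs_ideal.
    by apply: adjs_subW; exact: sub_adj.
  by apply: sub_adjs; exact: adj_in.
have iA := adjs_ideal s iW; apply: adjs_min.
- exact: adj_ideal.
- apply: adj_min; [exact: adj_ideal | | exact: adj_in].
  by apply: (subset_trans (@sub_adjs _ W s)); exact: sub_adj.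
- by move=> v sv; apply: sub_adj; exact: adjs_in.
Qed.

(** The powers of [x] filter [R / (W + (x^N))] by [N] quotients of
    [R / (W + (x))]. *)
Lemma colength_exp W x L N : is_ideal W ->
  colength_le (adj x W) L -> colength_le (adj (x ^+ N) W) (L * N).
Proof.
move=> iW [s [sL cs sT]]; elim: N => [|N [s' [s'L cs' s'T]]].
  exists [::]; split=> //=; apply/seteqP; split=> // z _; exists z.
  by rewrite mulr1 subrr; exact: ideal0.
have iN := adj_ideal (x ^+ N.+1) iW.
have [|||cxs sub] := @compser_mul (adj x W) (adj (x ^+ N.+1) W) (x ^+ N) s _ _ _ cs.
- exact: adj_ideal.
- by [].
- move=> w [a Wa]; exists a.
  have -> : x ^+ N * w - a * x ^+ N.+1 = x ^+ N * (w - a * x) by rewrite exprS; ring.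
  exact: idealMl.
have step : adj (x ^+ N) W = adjs (adj (x ^+ N.+1) W) (map ( *%R (x ^+ N)) s).
  apply/seteqP; split.
    apply: adj_min; first exact: adjs_ideal.
      apply: (@subset_trans _ (adj (x ^+ N.+1) W)); first exact: sub_adj.
      exact: sub_adjs.
    by have := sub 1; rewrite mulr1; apply; rewrite -sT.
  have iN' := adj_ideal (x ^+ N) iW.
  apply: adjs_min => // [|w /mapP[v _ ->]]; last by apply: idealMr => //; exact: adj_in.
  apply: adj_min => //; first exact: sub_adj.
  by rewrite exprS; apply: idealMl => //; exact: adj_in.
exists (s' ++ map ( *%R (x ^+ N)) s); split.
- by rewrite size_cat size_map mulnSr leq_add.
- by apply: compser_cat => //; rewrite -step.
- by rewrite adjs_cat -step.
Qed.

Lemma colength_exps W xs L N : is_ideal W -> colength_le (adjs W xs) L ->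
  colength_le (adjs W [seq x ^+ N | x <- xs]) (L * N ^ size xs).
Proof.
elim: xs W L => [|x xs IH] W L iW /=; first by rewrite expn0 muln1.
move=> lenL; rewrite expnSr mulnA adj_adjs // mulnAC; apply: IH.
  exact: adj_ideal.
by rewrite -adj_adjs //; apply: colength_exp => //; exact: adjs_ideal.
Qed.

Definition dim_le Q r : Prop :=
  forall k (P : 'I_k.+1 -> set R), is_prime_chain P -> Q `<=` P ord0 -> (k <= r)%N.

Lemma prime_chain_cons k (P : 'I_k.+1 -> set R) P0 : is_prime_chain P ->
  is_prime_ideal P0 -> P0 `<` P ord0 ->
  is_prime_chain (R := R)
    (fun i : 'I_k.+2 => if unlift ord0 i is Some j then P j else P0).
Proof.
move=> [Pp Plt] pP0 P0P; split=> [i|i j]; first by case: unliftP.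
case: unliftP => [i' ->|->]; case: unliftP => [j' ->|->] //=.
  by rewrite ltnS; exact: Plt.
move=> _; have [->//|j'0] := eqVneq j' ord0.
have [PP nPP] : P ord0 `<` P j'.
  by apply: Plt; rewrite lt0n; apply: contra j'0 => /eqP j'0; apply/eqP/val_inj.
have [P0sub nP0sub] := P0P; split; first exact: subset_trans PP.
by move=> PP0; apply: nPP; exact: subset_trans P0sub.
Qed.

Lemma prime_chain1 P P' : is_prime_ideal P -> is_prime_ideal P' -> P `<` P' ->
  is_prime_chain (R := R) (fun i : 'I_2 => if unlift ord0 i is Some j then P' else P).
Proof.
move=> pP pP' PP'; apply: (@prime_chain_cons 0 (fun=> P')) => //; split=> // i j.
by rewrite !ord1.
Qed.

Lemma dim0_max Q P : dim_le Q 0 -> is_prime_ideal P -> Q `<=` P -> P = mm.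
Proof.
move=> dimQ pP QP; have Pmm := prime_sub_max pP.
apply/seteqP; split=> //; apply: contrapT => nmmP.
have := dimQ _ _ (prime_chain1 pP max_prime (conj Pmm nmmP)).
by rewrite unlift_none; move/(_ QP).
Qed.

(** Each parameter avoids the primes of a list that covers [Q], other than
    [mm], and so shortens all chains of primes above [Q]. *)
Lemma parameters r Q : is_ideal Q -> dim_le Q r -> exists xs,
  [/\ (size xs <= r)%N, forall x, x \in xs -> mm x &
      forall z, mm z -> exists k, adjs Q xs (z ^+ k)].
Proof.
elim: r Q => [|r IH] Q iQ dimQ; have [L [Lp Lc Ln]] := prime_cover noeR iQ.
  exists [::]; split=> // z mz; apply: Ln => P /Lp[pP QP].
  by rewrite (dim0_max dimQ pP QP).
pose L' := [seq P <- L | `[< P <> mm >]].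
have [P|x mx xL'] := @prime_avoidance _ mm L' imm.
  rewrite mem_filter => /andP[/asboolP Pmm /Lp[pP _]]; split=> // mmP.
  by apply: Pmm; apply/seteqP; split=> //; exact: prime_sub_max.
have [||xs [sxs mxs rad]] := IH (adj x Q); first exact: adj_ideal.
  move=> k P cP QxP; have QP : Q `<=` P ord0.
    by apply: subset_trans QxP; exact: sub_adj.
  have Px : P ord0 x by apply: QxP; exact: adj_in.
  have [P' LP' P'P] := Lc _ (cP.1 ord0) QP; have [pP' QP'] := Lp _ LP'.
  have [P'mm|nP'mm] := EM (P' = mm).
    case: k P cP {QxP QP Px} P'P => // k P cP; rewrite P'mm => mmP.
    have [_ nPP] := cP.2 ord0 (lift ord0 ord0) isT; case: nPP.
    exact: subset_trans (prime_sub_max (cP.1 _)) mmP.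
  have nP'x : ~ P' x by apply: xL'; rewrite mem_filter LP' andbT; exact/asboolP.
  have P'ltP : P' `<` P ord0 by split=> // /(_ _ Px).
  have := dimQ _ _ (prime_chain_cons cP pP' P'ltP).
  by rewrite unlift_none => /(_ QP'); rewrite ltnS.
exists (xs ++ [:: x]); split.
- by rewrite size_cat addn1.
- by move=> y; rewrite mem_cat inE => /orP[/mxs|/eqP ->].
- by move=> z /rad; rewrite adjs_cat.
Qed.

(** Let [x_1, ..., x_n] be parameters, and [z_1, ..., z_l] generators of [mm].
    Since [R / mm] has length one and large powers of the [z_j] lie in
    [Q = (x_1, ..., x_n)], passing from [z_j] to its powers shows that [R / Q] has
    finite length; passing from [x_j] to [x_j^N] then costs a factor [N] for
    each of the [n] parameters. *)
Lemma colength_bound n : has_krull_dim R n -> exists C, forall N, (0 < N)%N ->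
  exists W, [/\ is_ideal W, W `<=` ideal_pow mm N & colength_le W (C * N ^ n)].
Proof.
move=> [_ dimR]; have i00 := @is_ideal00 R.
have [|xs [sxs mxs rad]] := @parameters n _ i00; first by move=> k P /dimR.
set Q := adjs [set 0] xs in rad; have iQ : is_ideal Q := adjs_ideal xs i00.
have [zs zsE] := noeth_adjs noeR imm.
have mzs z : z \in zs -> mm z by rewrite zsE; exact: adjs_in.
have [e radQ] : exists e, forall z, z \in zs -> Q (z ^+ e).
  elim: zs {zsE} mzs => [|z zs IH] mzs; first by exists 0%N.
  have [|e eQ] := IH; first by move=> y zsy; apply: mzs; rewrite inE zsy orbT.
  have [k kQ] := rad z (mzs _ (mem_head _ _)).
  exists (k + e)%N => y; rewrite exprD inE => /predU1P[->|/eQ].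
    exact: idealMr.
  exact: idealMl.
have Qmm : Q `<=` mm by apply: adjs_min => // _ ->; exact: ideal0.
have Qzs : adjs Q zs = mm.
  apply/seteqP; split; first exact: adjs_min.
  by rewrite {1}zsE; apply: adjs_subW => _ ->; exact: ideal0.
have len_mm : colength_le (adjs Q zs) 1.
  rewrite Qzs; exists [:: 1]; split=> //=.
    by split=> // z; rewrite mulr1.
  by apply/seteqP; split=> // z _; exists z; rewrite mulr1 subrr; exact: ideal0.
have lenQ : colength_le Q (1 * e ^ size zs).
  have := colength_exps e iQ len_mm; rewrite (_ : adjs Q _ = Q) //.
  apply/seteqP; split; last exact: sub_adjs.
  by apply: adjs_min => // _ /mapP[z /radQ zQ ->].
exists (1 * e ^ size zs)%N => N N_gt0.
exists (adjs [set 0] [seq x ^+ N | x <- xs]); split; first exact: adjs_ideal.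
  apply: adjs_min; [exact: pow_ideal | |].
    by move=> _ ->; apply: ideal0; exact: pow_ideal.
  by move=> _ /mapP[x /mxs mx ->]; exact: pow_in.
have [s [sL cs sT]] := colength_exps N i00 lenQ.
exists s; split=> //; apply: leq_trans sL _.
by rewrite leq_mul2l leq_pexp2l ?orbT.
Qed.

End Local.

(** * Forms that vanish at more than [dim R] elements *)

Section PowImage.
Variables (A B : comNzRingType) (phi : {rmorphism A -> B}).

Lemma pow_image (I : set A) (J : set B) n : (forall x, I x -> J (phi x)) ->
  forall x, ideal_pow I n x -> ideal_pow J n (phi x).
Proof.
move=> IJ; elim: n => // n IH x.
apply: (@ideal_mul_min _ _ _ [set x | ideal_pow J n.+1 (phi x)]).
  split=> [|a u v Ju Jv] /=.
    by rewrite rmorph0; apply: ideal0; exact: ideal_mul_ideal.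
  by rewrite rmorphD rmorphM; apply: (ideal_mul_ideal _ _).2.
by move=> u v Iu Iv /=; rewrite rmorphM; apply: ideal_mul_in; [exact: IJ | exact: IH].
Qed.

End PowImage.

Section AnalyticIndependence.
Variables (R : comNzRingType) (mm : set R).
Hypotheses (noeR : noetherian R) (localR : is_local_with mm).
Let imm : is_ideal mm := max_ideal localR.

Section CoefficientIdeal.
Variable s : nat.
Implicit Types (F G : mpoly s R) (m : multinom s).

(** The extension of [mm] to the polynomial ring. *)
Definition coef_ideal : set (mpoly s R) := [set F | forall m, mm (mcoeff m F)].

Lemma coef_ideal_ideal : is_ideal coef_ideal.
Proof.
split=> [m|a u v au av m]; first by rewrite mcoeff0; exact: ideal0.
rewrite mcoeffD mcoeffM; apply: idealD => //; apply: ideal_sum => // k _.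
exact: idealMl.
Qed.

Lemma coef_ideal_mulX F m : coef_ideal (F * mpolyX R m) -> coef_ideal F.
Proof. by move=> mF k; rewrite -(mcoeffMX F m k); exact: mF. Qed.

Lemma multinom_split i m : (i <= mdeg m)%N ->
  exists m1 m2, mdeg m1 = i /\ m = mnm_add m1 m2.
Proof.
elim: i => [|i IH] im; first by exists mnm0, m; rewrite mdeg0 add0m.
have [m1 [m2 [m1i mE]]] := IH (ltnW im).
have m2gt0 : mdeg m2 != 0%N by move: im; rewrite mE mdegD m1i; lia.
have [j m2j] : exists j, m2 j != 0%N.
  apply/existsP; apply: contraNT m2gt0 => /existsPn m20.
  by rewrite mdegE big1 // => j _; apply/eqP; have := m20 j; rewrite negbK.
exists (mnm_add m1 (mnm1 j)), (mnm_sub m2 (mnm1 j)).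
rewrite mdegD mdeg1 m1i addn1; split=> //.
by rewrite mE -addmA [mnm_add (mnm1 j) _]addmC submK // lep1mP.
Qed.

(** Monomials of degree larger than [i] in elements of [mm] are monomials of
    degree [i] with coefficients in [mm]. *)
Lemma adjs_form (y : 'I_s -> R) W i (ms : seq (multinom s)) z :
  (forall j, mm (y j)) -> is_ideal W -> (forall m, m \in ms -> (i <= mdeg m)%N) ->
  adjs W [seq meval y (mpolyX R m) | m <- ms] z ->
  exists G, [/\ G \is homog i, W (z - meval y G) &
    forall m, m \notin ms -> mm (mcoeff m G)].
Proof.
move=> ymm iW; elim: ms z => [|m ms IH] z ims /=.
  move=> Wz; exists 0; rewrite dhomog0 meval0 subr0; split=> // m _.
  by rewrite mcoeff0; exact: ideal0.
case=> a /IH[|G [hG Wz Gms]]; first by move=> m' mm'; apply: ims; rewrite inE mm' orbT.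
have [m1 [m2 [m1i mE]]] := multinom_split (ims m (mem_head _ _)).
exists (G + (a * meval y (mpolyX R m2)) *: mpolyX R m1); split.
- by rewrite dhomogD // dhomogZ // dhomogX /= m1i.
- rewrite mevalD mevalZ -mulrA -mevalM -mpolyXD addmC -mE.
  by rewrite opprD addrA addrAC.
- move=> m'; rewrite inE negb_or => /andP[m'm m'ms].
  rewrite mcoeffD mcoeffZ mcoeffX; apply: idealD => //; first exact: Gms.
  have [m1m'|_] := eqVneq m1 m'; last by rewrite mulr0; exact: ideal0.
  rewrite mulr1; apply: idealMl => //; have : mdeg m2 != 0%N.
    apply: contra m'm => m20; have /eqP m20' : m2 == mnm0 by rewrite -mdeg_eq0.
    by rewrite mE m20' addm0 m1m'.
  rewrite -lt0n => m2_gt0; rewrite mevalX -(pow1 imm).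
  by apply: (pow_le m2_gt0); exact: mon_pow.
Qed.

End CoefficientIdeal.

(** The list is sorted by degree, so that a relation expressing a monomial
    through later ones contains no monomials of smaller degree. *)
Definition box_monomials s M : seq (multinom s) :=
  sort (relpre mdeg leq)
    [seq Multinom [tuple (g i : nat) | i < s] | g : {ffun 'I_s -> 'I_M}].

Lemma size_box s M : size (box_monomials s M) = (M ^ s)%N.
Proof. by rewrite size_sort size_map -cardE card_ffun !card_ord. Qed.

Lemma uniq_box s M : uniq (box_monomials s M).
Proof.
rewrite sort_uniq map_inj_uniq ?enum_uniq // => g g' gg'.
apply/ffunP => i; apply/val_inj; have := congr1 (fun m : multinom s => m i) gg'.
by rewrite /fun_of_multinom /= !tnth_mktuple.
Qed.

Lemma mdeg_box s M m : m \in box_monomials s M -> (mdeg m <= s * M)%N.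
Proof.
rewrite mem_sort => /mapP[g _ ->]; rewrite mdegE.
rewrite -[s in (s * M)%N]card_ord -sum_nat_const.
by apply: leq_sum => i _; rewrite /fun_of_multinom /= tnth_mktuple ltnW.
Qed.

Lemma box_split s M j : (j < M ^ s)%N -> exists m ms,
  [/\ drop j (box_monomials s M) = m :: ms, drop j.+1 (box_monomials s M) = ms,
      (mdeg m <= s * M)%N, m \notin ms &
      forall m', m' \in ms -> (mdeg m <= mdeg m')%N].
Proof.
rewrite -size_box => jlt; set B := box_monomials s M in jlt *.
have Bj := drop_nth mnm0 jlt; exists (nth mnm0 B j), (drop j.+1 B).
have : uniq (drop j B) by apply: drop_uniq; exact: uniq_box.
have : sorted (relpre mdeg leq) (drop j B).
  apply: drop_sorted; apply: sort_sorted => m m'; exact: leq_total.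
rewrite Bj /= => pB /andP[nB _]; split=> //; first by apply: mdeg_box; exact: mem_nth.
apply/allP; apply: order_path_min pB => m1 m2 m3; exact: leq_trans.
Qed.

(** Suppose that all relations have coefficients in [mm]. Any form [F] of degree
    [i] satisfies [y_0^i F = F(y) X_0^i] modulo relations. If [F(y)] lies in a
    power of [mm] that is high compared with [i], the Artin-Rees lemma for [y_0]
    in [R[X]] puts [F] into [mm R[X]]. Yet there are forms [F] outside
    [mm R[X]] with this property for length reasons: [R / W] has length at most
    [C N^n] for some [W] in [mm^N], and there are [M^(n+1)] monomials in
    [n + 1] elements with exponents below [M], where [N] is proportional to
    [M]. *)
Lemma relation_exists k n (y : 'I_n.+1 -> R) : has_krull_dim R k -> (k <= n)%N ->
  (forall i, mm (y i)) -> exists F m, rees y F = 0 /\ ~ mm (mcoeff m F).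
Proof.
move=> dimR kn ymm; apply: contrapT => norel.
have {norel} relmm F : rees y F = 0 -> coef_ideal F.
  by move=> yF m; apply: contrapT => nmF; apply: norel; exists F, m.
have iNN := @coef_ideal_ideal n.+1.
pose X0 := mpolyX R (mnm1 (@ord0 n)); pose y0 := mpolyC n.+1 (y ord0).
have reesX0 : rees y X0 = y ord0 *: 'X.
  by rewrite reesX mdeg1 expr1 -mevalX mevalXU.
(* The relations, saturated with respect to [y_0] so that [y_0] can be
   cancelled modulo [K]; they remain in [mm R[X]], as [X_0] is regular there. *)
pose K := [set F | exists h, rees y (y0 ^+ h * F) = 0].
have iK : is_ideal K.
  split; first by exists 0%N; rewrite mulr0 rmorph0.
  move=> a u v [h hu] [l lv]; exists (h + l)%N.
  have -> : y0 ^+ (h + l) * (a * u + v) =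
      y0 ^+ l * a * (y0 ^+ h * u) + y0 ^+ h * (y0 ^+ l * v) by rewrite exprD; ring.
  by rewrite rmorphD [X in X + _]rmorphM [X in _ + X]rmorphM hu lv !mulr0 addr0.
have KNN : K `<=` coef_ideal (s := n.+1).
  move=> F [h hF]; apply: (@coef_ideal_mulX _ _ (mnm_muln (mnm1 ord0) h)).
  rewrite -mpolyXn; apply: relmm; move: hF.
  rewrite !rmorphM !rmorphXn /= reesC -/X0 reesX0 -mul_polyC exprMn => hF.
  by rewrite mulrC -mulrA mulrCA hF mulr0.
have [c ARc] := artin_rees y0 (@noeth_mpoly _ n.+1 noeR) iNN iK.
have ARi i : forall N z u, ideal_pow (coef_ideal (s := n.+1)) N u ->
    K (y0 ^+ i * z - u) ->
    exists2 w, ideal_pow (coef_ideal (s := n.+1)) (N - c * i) w & K (z - w).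
  elim: i => [|i IH] N z u Iu Kz.
    by rewrite expr0 mul1r in Kz; exists u; rewrite ?muln0 ?subn0.
  have [|w Iw [h Kw]] := ARc N (y0 ^+ i * z) u Iu; first by rewrite mulrA -exprS.
  have [|w' Iw' Kw'] := IH (N - c)%N z w Iw.
    by exists h.+1; rewrite exprSr -mulrA.
  by exists w' => //; rewrite mulnS subnDA.
have [C lenC] := colength_bound noeR localR dimR.
(* [N] exceeds [c] times the degree of every monomial in the list, and is at
   most [B M], so that [C N^n <= C B^n M^n < M^(n+1)]. *)
pose B := (c * n.+1 + 1)%N; pose M := (C * B ^ n).+1; pose N := (c * (n.+1 * M) + 1)%N.
have N_gt0 : (0 < N)%N by rewrite /N addn1.
have [W [iW WN [s [sL cs sT]]]] := lenC N N_gt0.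
have sM : (size s < M ^ n.+1)%N.
  apply: leq_ltn_trans sL _; have NBM : (N <= B * M)%N by rewrite /N /B; nia.
  have NBMn l : (N ^ l <= (B * M) ^ l)%N by elim: l => // l IHl; rewrite !expnS leq_mul.
  apply: (@leq_ltn_trans (C * (B * M) ^ n)).
    by rewrite leq_mul2l (leq_trans _ (NBMn n)) ?orbT // leq_pexp2l.
  by rewrite expnMn mulnA expnS ltn_pmul2r // expn_gt0.
pose D j := adjs W [seq meval y (mpolyX R m) | m <- drop j (box_monomials n.+1 M)].
have [|||j jM Dj] :=
  @chain_pigeonhole _ _ noeR localR W s D (M ^ n.+1) iW cs sT _ _ _ sM.
- by move=> j; exact: adjs_ideal.
- by move=> j; exact: sub_adjs.
- move=> j; rewrite /D; have [jM|jM] := ltnP j (M ^ n.+1); last first.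
    by rewrite !drop_oversize ?size_box // (leq_trans jM).
  have [m [ms [-> -> _ _ _]]] := box_split jM.
  exact: sub_adj.
have [m [ms [Bj Bj1 mM mms msge]]] := box_split jM.
have [|G [hG Wm Gms]] :=
    adjs_form (i := mdeg m) (z := meval y (mpolyX R m)) ymm iW msge.
  by rewrite -Bj1; apply: Dj; rewrite /D Bj; apply: adj_in; exact: adjs_ideal.
pose F := mpolyX R m - G.
have hF : F \is homog (mdeg m) by rewrite dhomogD ?dhomogN // dhomogX /=.
have nF : ~ coef_ideal F.
  move=> /(_ m); rewrite mcoeffB mcoeffX eqxx => m1G.
  by apply: (max_proper localR); apply: (idealBl imm m1G); exact: Gms.
have WF : ideal_pow mm N (meval y F) by apply: WN; rewrite mevalB.
have [||w Iw Kw] := ARi (mdeg m) N F (mpolyC n.+1 (meval y F) * X0 ^+ mdeg m).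
- apply: idealMr; first exact: pow_ideal.
  apply: (@pow_image _ _ (@mpolyC n.+1 R) mm) WF => x mx m'.
  by rewrite mcoeffC; exact: idealMr.
- exists 0%N; rewrite mul1r rmorphB !rmorphM !rmorphXn /= !reesC reesX0.
  rewrite (rees_form _ hF).
  by rewrite exprZn -!mul_polyC -polyC_exp mulrCA subrr.
apply: nF; apply: (idealBl iNN (KNN _ Kw)); rewrite -(pow1 iNN).
by apply: pow_le Iw; rewrite /N; nia.
Qed.

Lemma form_exists k n (y : 'I_n.+1 -> R) : has_krull_dim R k -> (k <= n)%N ->
  (forall i, mm (y i)) -> exists i F m,
    [/\ F \is homog i, meval y F = 0 & ~ mm (mcoeff m F)].
Proof.
move=> dimR kn ymm; have [F [m [yF nmF]]] := relation_exists dimR kn ymm.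
pose G := \sum_(m' <- msupp F | mdeg m' == mdeg m) mcoeff m' F *: mpolyX R m'.
exists (mdeg m), G, m; split.
- by apply: rpred_sum => m' mm'; rewrite dhomogZ // dhomogX.
- have := congr1 (fun P : {poly R} => P`_(mdeg m)) yF.
  rewrite coef0 reesE coef_sum => <-; rewrite raddf_sum big_mkcond /=.
  apply: eq_bigr => m' _; rewrite coefZ coefXn eq_sym; case: eqP => _.
    by rewrite mevalZ mevalX mulr1.
  by rewrite mulr0.
- rewrite raddf_sum big_mkcond /=; have mF : m \in msupp F.
    by rewrite mcoeff_msupp; apply: contra_notN nmF => /eqP ->; exact: ideal0.
  rewrite (bigD1_seq m) ?msupp_uniq //= !eqxx mcoeffZ mcoeffX eqxx mulr1 big1 ?addr0 //.
  move=> m' /negbTE m'm; case: ifP => // _.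
  by rewrite mcoeffZ mcoeffX m'm mulr0.
Qed.

End AnalyticIndependence.

(** * Reductions *)

Section Reductions.
Variables (R : comNzRingType) (mm : set R).
Hypotheses (noeR : noetherian R) (localR : is_local_with mm).
Hypothesis inf_residue : infinite_set (quotient_set mm).
Let imm : is_ideal mm := max_ideal localR.

Lemma residue_avoid (L : seq R) : exists a, forall b, b \in L -> ~ mm (a - b).
Proof.
apply: contrapT => noa; apply: inf_residue.
apply: (@sub_finite_set _ _ ((fun x : R => [set x + y | y in mm]) @` [set` L])).
  move=> _ [x _ <-]; have [b bL mxb] : exists2 b, b \in L & mm (x - b).
    apply: contrapT => nob; apply: noa; exists x => b bL mxb.
    by apply: nob; exists b.
  exists b => //; apply/seteqP; split=> _ [y my <-].
    exists (b - x + y); first by apply: idealD => //; rewrite -opprB; exact: idealN.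
    by ring.
  by exists (x - b + y); [exact: idealD | ring].
exact/finite_image/finite_seq.
Qed.

(** Over the infinite residue field a nonzero polynomial cannot vanish outside
    a finite set. The list [L] holds the roots already divided out. *)
Lemma poly_vanish (L : seq R) (g : {poly R}) :
  (forall a, (forall b, b \in L -> ~ mm (a - b)) -> mm g.[a]) ->
  forall i, mm g`_i.
Proof.
have [n] := ubnP (size g); elim: n => // n IH in L g *; rewrite ltnS => gn gL.
have [a aL] := residue_avoid L; have mga := gL a aL.
have /factor_theorem[h hE] : root (g - g.[a]%:P) a.
  by rewrite /root !hornerE subrr.
have gE : g = h * ('X - a%:P) + g.[a]%:P by rewrite -hE subrK.
have mh i : mm h`_i.
  have [->|h0] := eqVneq h 0; first by rewrite coef0; exact: ideal0.
  apply: (IH (a :: L)).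
    have hs : size (g - g.[a]%:P) = (size h).+1.
      by rewrite hE size_Mmonic ?monicXsubC // size_XsubC addn2.
    rewrite -hs (leq_trans _ gn) //; have [->|g0] := eqVneq g 0.
      by rewrite horner0 subr0.
    rewrite (leq_trans (size_polyD _ _)) // geq_max leqnn size_polyN.
    by rewrite (leq_trans (size_polyC_leq1 _)) // lt0n size_poly_eq0.
  move=> b bL; have mgb : mm g.[b].
    by apply: gL => c cL; apply: bL; rewrite inE cL orbT.
  have [_ _ mmp] := max_prime noeR localR; have [] := mmp h.[b] (b - a) => //.
    have -> : h.[b] * (b - a) = g.[b] - g.[a].
      by rewrite [in g.[b]]gE !hornerE addrK.
    exact: idealB.
  by move/bL; rewrite inE eqxx => /(_ isT).
rewrite gE => i; rewrite coefD coefC mulrBr coefB coefMX coefMC.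
apply: idealD => //; last by case: eqP => // _; exact: ideal0.
apply: idealB => //; last exact: idealMr.
by case: eqP => // _; exact: ideal0.
Qed.

Lemma poly_nonvanish (g : {poly R}) i : ~ mm g`_i ->
  exists a, ~ mm a /\ ~ mm g.[a].
Proof.
move=> ngi; apply: contrapT => noa; apply/ngi/(@poly_vanish [:: 0]) => a a0.
apply: contrapT => nga; apply: noa; exists a; split=> //.
by have := a0 0; rewrite subr0 inE; apply.
Qed.

Lemma digits_inj s M (a b : 'I_s -> nat) :
  (forall j, a j < M)%N -> (forall j, b j < M)%N ->
  (\sum_j a j * M ^ j = \sum_j b j * M ^ j)%N -> a =1 b.
Proof.
elim: s a b => [|s IH] a b aM bM; first by move=> _ [].
have splitE (c : 'I_s.+1 -> nat) : (\sum_j c j * M ^ j =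
    (\sum_(j < s) c (lift ord0 j) * M ^ j) * M + c ord0)%N.
  rewrite big_ord_recl expn0 muln1 addnC; congr (_ + _)%N.
  by rewrite big_distrl; apply: eq_bigr => j _; rewrite /= /bump expnS; lia.
have M0 : (0 < M)%N by exact: leq_ltn_trans (aM ord0).
rewrite !splitE => E; have E0 : a ord0 = b ord0.
  by have := congr1 (modn^~ M) E; rewrite /= !modnMDl !modn_small.
move: E; rewrite E0 => /addIn/eqP; rewrite eqn_pmul2r // => /eqP.
move/(IH (a \o lift ord0) (b \o lift ord0)) => /= ab j.
have {}ab := ab (fun j => aM _) (fun j => bM _).
by have [j' ->|->] := unliftP ord0 j; first exact: ab.
Qed.

(** Evaluation at [(t, t^M, t^(M^2), ...)] for large [M] sends distinct
    monomials to distinct powers of [t], which leaves a problem in one variable. *)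
Lemma mpoly_nonvanish s (F : mpoly s.+1 R) m : ~ mm (mcoeff m F) ->
  exists v, ~ mm (v ord0) /\ ~ mm (meval v F).
Proof.
move=> nFm; pose M := msize F.
pose kappa (m : multinom s.+1) := (\sum_j m j * M ^ j)%N.
have FM m' j : m' \in msupp F -> (m' j < M)%N.
  move=> /(msize_mdeg_lt (p := F)); apply: leq_ltn_trans.
  by rewrite mdegE (bigD1 j) //= leq_addr.
have mF : m \in msupp F.
  by rewrite mcoeff_msupp; apply: contra_notN nFm => /eqP ->; exact: ideal0.
pose g := \sum_(m' <- msupp F) mcoeff m' F *: 'X^(kappa m').
have gm : g`_(kappa m) = mcoeff m F.
  rewrite coef_sum (bigD1_seq m) ?msupp_uniq //= coefZ coefXn eqxx mulr1.
  rewrite big_seq_cond big1 ?addr0 // => m' /andP[m'F m'm].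
  rewrite coefZ coefXn; case: eqP => [/digits_inj mm'|]; last by rewrite mulr0.
  by case/eqP: m'm; apply/mnmP => j; rewrite mm' // => *; exact: FM.
have [|a [na nga]] := @poly_nonvanish g (kappa m); first by rewrite gm.
exists (fun j => a ^+ (M ^ j)); split; first by rewrite expn0 expr1.
suff -> : meval (fun j : 'I_s.+1 => a ^+ (M ^ j)) F = g.[a] by [].
rewrite mevalE horner_sum; apply: eq_bigr => m' _.
rewrite hornerZ hornerXn; congr (_ * _).
rewrite -prodrXr; apply: eq_bigr => j _.
by rewrite -exprM mulnC.
Qed.

Lemma form_scale s i (F : mpoly s R) v (c : R) : F \is homog i ->
  meval (fun j => v j * c) F = meval v F * c ^+ i.
Proof.
move=> /formP hF; rewrite !mevalE mulr_suml big_seq [RHS]big_seq.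
apply: eq_bigr => m /hF <-; rewrite -mulrA mdegE -prodrXr -big_split /=.
by congr (_ * _); apply: eq_bigr => j _; rewrite exprMn.
Qed.

(** Telescoping, one variable at a time. *)
Lemma mon_congr s (y w : 'I_s -> R) J J' i (m : multinom s) :
  is_ideal J -> (forall j, J (y j)) -> (forall j, J (w j)) ->
  (forall j, J' (y j - w j)) -> mdeg m = i.+1 ->
  ideal_mul J' (ideal_pow J i) (\prod_j y j ^+ m j - \prod_j w j ^+ m j).
Proof.
move=> iJ Jy Jw J'yw; elim: i m => [|i IH] m mi.
  have /mdeg1P[j /eqP ->] : mdeg m == 1%N by rewrite mi.
  rewrite -!mevalX !mevalXU -[_ - _]mulr1.
  by apply: ideal_mul_in => //; exact: J'yw.
have [|m1 [m2 [m1i mE]]] := @multinom_split s i.+1 m; first by rewrite mi.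
have /mdeg1P[j /eqP m2j] : mdeg m2 == 1%N by move: mi; rewrite mE mdegD m1i; lia.
rewrite -!mevalX mE m2j mpolyXD !mevalM !mevalXU !mevalX.
set y1 := \prod_j _; set w1 := \prod_j _.
have -> : y1 * y j - w1 * w j = (y j - w j) * w1 + y j * (y1 - w1) by ring.
apply: (idealD (is_ideal_gen _)).
  apply: ideal_mul_in; first exact: J'yw.
  by rewrite -m1i; exact: mon_pow.
rewrite [y j * _]mulrC.
apply: (ideal_mul_min (ideal_colon (y j) (is_ideal_gen _)) _ (IH m1 m1i)) => u v J'u Jv.
by rewrite /= -mulrA [v * _]mulrC; apply: ideal_mul_in => //; exact: ideal_mul_in.
Qed.

Lemma form_congr s (y w : 'I_s -> R) J J' i (F : mpoly s R) :
  is_ideal J -> (forall j, J (y j)) -> (forall j, J (w j)) ->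
  (forall j, J' (y j - w j)) -> F \is homog i.+1 ->
  ideal_mul J' (ideal_pow J i) (meval y F - meval w F).
Proof.
move=> iJ Jy Jw J'yw /formP hF; rewrite !mevalE -sumrB big_seq.
apply: ideal_sum => [|m /hF mi]; first exact: is_ideal_gen.
rewrite -mulrBr; apply: (idealMl _ (is_ideal_gen _)); exact: mon_congr.
Qed.

Lemma form0_const s (y w : 'I_s -> R) (F : mpoly s R) : F \is homog 0 ->
  meval y F = meval w F.
Proof.
move=> /formP hF; rewrite !mevalE big_seq [RHS]big_seq; apply: eq_bigr => m /hF/eqP.
rewrite mdeg_eq0 => /eqP ->; congr (_ * _); rewrite !big1 // => j _.
  by rewrite mnm0E.
by rewrite mnm0E.
Qed.

(** If more than [dim R] elements [y_j] satisfy a form [F] with unit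
    coefficients, choose [v] with [v_0 = 1] such that [F(v)] is a unit, and
    replace [y_j] by [y_j - v_j y_0]. The relation then puts a power of [y_0]
    into the ideal [J'] of the new elements, which are one fewer. *)
Lemma reduction_step k n (y : 'I_n.+1 -> R) : has_krull_dim R k -> (k <= n)%N ->
  (forall j, mm (y j)) -> exists (y' : 'I_n -> R) (r : nat),
    ideal_gen (range y') `<=` ideal_gen (range y) /\
    forall N, ideal_pow (ideal_gen (range y)) (N + r) `<=`
              ideal_pow (ideal_gen (range y')) N.
Proof.
move=> dimR kn ymm; have [i [F [m [hF Fy nFm]]]] := form_exists noeR localR dimR kn ymm.
have [v0 [nv0 nFv0]] := mpoly_nonvanish nFm.
have [c cv0] := local_unit noeR localR nv0.
pose v j := v0 j * c; have v1 : v ord0 = 1 by rewrite /v mulrC.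
have nFv : ~ mm (meval v F).
  rewrite (form_scale _ _ hF) => mFc; apply: nFv0.
  have -> : meval v0 F = meval v0 F * c ^+ i * v0 ord0 ^+ i.
    by rewrite -mulrA -exprMn cv0 expr1n mulr1.
  exact: idealMr.
case: i => [|i] in hF *.
  by case: nFv; rewrite -(form0_const y v hF) Fy; exact: ideal0.
pose u := y ord0; pose w j := v j * u.
pose y' j := y (lift ord0 j) - w (lift ord0 j).
set J := ideal_gen (range y); set J' := ideal_gen (range y').
have iJ : is_ideal J := is_ideal_gen _; have iJ' : is_ideal J' := is_ideal_gen _.
have Jy j : J (y j) by apply: sub_ideal_gen; exists j.
have Jw j : J (w j) by exact: (idealMl _ iJ (Jy _)).
have J'yw j : J' (y j - w j).
  have [j' ->|->] := unliftP ord0 j; first by apply: sub_ideal_gen; exists j'.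
  by rewrite /w v1 mul1r subrr; exact: ideal0.
have J'J : J' `<=` J.
  by apply: ideal_gen_min => // _ [j _ <-]; exact: (idealB iJ (Jy _) (Jw _)).
have iJ'J : is_ideal (ideal_mul J' (ideal_pow J i)) := ideal_mul_ideal _ _.
have [b bFv] := local_unit noeR localR nFv.
have Ju : ideal_mul J' (ideal_pow J i) (u ^+ i.+1).
  have := form_congr iJ Jy Jw J'yw hF; rewrite Fy sub0r (form_scale _ _ hF).
  move=> /(idealMl (- b) iJ'J); rewrite mulNr mulrN opprK mulrA bFv.
  by rewrite mul1r.
have JJ' : ideal_pow J i.+1 `<=` ideal_mul J' (ideal_pow J i).
  move=> z /pow_form[G hG <-]; apply: (idealBl iJ'J (form_congr iJ Jy Jw J'yw hG)).
  by rewrite (form_scale _ _ hG); exact: (idealMl _ iJ'J Ju).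
exists y', i; split=> // N z; suff : ideal_pow J (N + i) `<=`
    ideal_mul (ideal_pow J' N) (ideal_pow J i).
  move=> sub /sub; apply: ideal_mul_min; first exact: pow_ideal.
  by move=> a a' Ja _; apply: idealMr => //; exact: pow_ideal.
elim: N {z} => [|N IH].
  by move=> z Jz; rewrite -[z]mul1r; exact: ideal_mul_in.
rewrite addSn powS; apply: ideal_mul_min; first exact: ideal_mul_ideal.
move=> x z Jx /IH Jz; rewrite mulrC.
apply: (ideal_mul_min (ideal_colon x (ideal_mul_ideal _ _)) _ Jz) => a a' J'a Ja' /=.
have : ideal_pow J i.+1 (x * a') by rewrite powS; exact: ideal_mul_in.
rewrite -mulrA [a' * x]mulrC [a * _]mulrC => /JJ' Jxa.
apply: (ideal_mul_min (ideal_colon a (ideal_mul_ideal _ _)) _ Jxa) => e e' J'e Je' /=.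
by rewrite mulrAC; apply: ideal_mul_in => //; exact: ideal_mul_in.
Qed.

(** The analytic spread is at most the dimension: as long as there are more
    than [k] generators, one of them can be removed. *)
Theorem reduction_exists k d (f : 'I_d -> R) : has_krull_dim R k ->
  (forall j, mm (f j)) -> exists s (g : 'I_s -> R) (r : nat),
    [/\ (s <= k)%N, ideal_gen (range g) `<=` ideal_gen (range f) &
        forall N, ideal_pow (ideal_gen (range f)) (N + r) `<=`
                  ideal_pow (ideal_gen (range g)) N].
Proof.
move=> dimR; elim: d f => [|d IH] f fmm.
  by exists 0%N, f, 0%N; split=> // N; rewrite addn0.
have [dk|kd] := ltnP d k.
  by exists d.+1, f, 0%N; split=> // N; rewrite addn0.
have [f' [r [f'f ff']]] := reduction_step dimR kd fmm.
have [j|s [g [r' [sk gf' f'g]]]] := IH f'.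
  apply: (ideal_gen_min imm (S := range f)); first by move=> _ [l _ <-].
  by apply: f'f; apply: sub_ideal_gen; exists j.
exists s, g, (r' + r)%N; split=> //; first exact: subset_trans gf' f'f.
by move=> N; rewrite addnA; apply: subset_trans (f'g N); exact: ff'.
Qed.

End Reductions.

(** * Comparison of the closures *)

Section Comparison.
Variables (R : comNzRingType) (K : realType) (p : nat).
Hypotheses (noeR : noetherian R) (charR : p \in [pchar R]).
Variables (a I : set R) (t : K).

Let p_gt1 : (1 < p)%N := prime_gt1 (pcharf_prime charR).

(** The multiplier [c'] compensates the passage from [I] to the smaller ideal
    of [g]; the strict inequality needed on exponents comes from [0 < k]. *)
Lemma closure_sub_tight s (g : 'I_s -> R) c' k m : (s <= k)%N -> (0 < k)%N ->
  ideal_gen (range g) `<=` I -> ring_circ R c' ->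
  (forall N z, ideal_pow I N z -> ideal_pow (ideal_gen (range g)) N (c' * z)) ->
  a_integral_closure a t (ideal_pow I (k + m))
    `<=` a_tight_closure p a t (ideal_pow I m.+1).
Proof.
move=> sk k_gt0 gI cR' c'I x [c cR [N xN]].
exists (c' * c); first exact: circM.
exists N => e Ne _ [y ay <-].
have q_big : (N <= p ^ e)%N by exact: leq_trans Ne (ltnW (ltn_expl e p_gt1)).
apply: (frobenius_pow_sub (pow_sub (n := m.+1) gI)).
apply: (@pow_frobenius _ _ _ _ _ g _ ((k + m) * p ^ e)) => //.
- exact: ltnW.
- by have : (0 < p ^ e)%N by [rewrite expn_gt0 (ltnW p_gt1)]; nia.
- rewrite -!mulrA; apply: c'I; rewrite -powM mulrA.
  by apply: (xN _ q_big); exists y.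
Qed.

Hypotheses (ideal_a : is_ideal a) (ideal_I : is_ideal I) (t_gt0 : 0 < t).

(** The constants [C] and [r] are eventually smaller than [q], which is what
    the exponents gain when [m] replaces [m.+1]. *)
Lemma closure_sub_frobenius s (g : 'I_s -> R) r k m : (s <= k)%N -> (1 <= m)%N ->
  ideal_gen (range g) `<=` I ->
  (forall N, ideal_pow I (N + r) `<=` ideal_pow (ideal_gen (range g)) N) ->
  a_integral_closure a t (ideal_pow I (k + m))
    `<=` a_frobenius_closure p a t (ideal_pow I m).
Proof.
move=> sk m_gt0 gI Ig x /(drop_multiplier noeR charR ideal_a ideal_I t_gt0)[C [E xE]].
exists (E + C + r)%N => e Ee _ [y ay <-].
have q_big : (C + r < p ^ e)%N by apply: leq_ltn_trans (ltn_expl e p_gt1); lia.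
apply: (frobenius_pow_sub (pow_sub (n := m) gI)).
apply: (@pow_frobenius _ _ _ _ _ g _ ((k + m) * p ^ e - C - r)) => //.
- exact: ltnW.
- nia.
- apply: Ig; apply: (@pow_le _ _ _ ((k + m) * p ^ e - C)).
    have : (p ^ e <= (k + m) * p ^ e)%N by rewrite leq_pmull // addn_gt0 m_gt0 orbT.
    by lia.
  by apply: xE => //; lia.
Qed.

End Comparison.

Theorem theorem4p5 (R : comNzRingType) (K : realType) (p : nat)
  (noethR : noetherian R) (charR : p \in [pchar R])
  (a I : set R) (ideal_a : is_ideal a) (ideal_I : is_ideal I)
  (height_a : positive_height a) (height_I : positive_height I)
  (d : nat) (gen_I : is_generated_by d I) (t : K) (t_gt0 : 0 < t) :
  [/\ (forall m : nat,
         a_integral_closure a t (ideal_pow I (d + m))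
           `<=` a_tight_closure p a t (ideal_pow I m.+1)),
      (forall m : nat, (1 <= m)%N ->
         a_integral_closure a t (ideal_pow I (d + m))
           `<=` a_frobenius_closure p a t (ideal_pow I m))
    & (forall (mm : set R) (n : nat),
         is_local_with mm -> has_krull_dim R n ->
         infinite_set (quotient_set mm) ->
         (forall m : nat,
            a_integral_closure a t (ideal_pow I (n + m))
              `<=` a_tight_closure p a t (ideal_pow I m.+1)) /\
         (forall m : nat, (1 <= m)%N ->
            a_integral_closure a t (ideal_pow I (n + m))
              `<=` a_frobenius_closure p a t (ideal_pow I m)))].
Proof.
have [f If] := gen_I.
have fI : ideal_gen (range f) `<=` I by rewrite -If.
(* Otherwise [I] would be zero and lie in a minimal prime. *)
have d_gt0 : (0 < d)%N.
  case: d f gen_I If fI => // f _ If _; have [P mP] := min_prime_exists noethR.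
  case: (height_I _ mP); rewrite If; apply: ideal_gen_min; first by case: mP => -[].
  by move=> z [[j j0]].
split=> [m|m m_gt0|mm n localR dimR inf_residue].
- apply: (closure_sub_tight charR (leqnn d) d_gt0 fI (@circ1 R)) => N z.
  by rewrite mul1r -If.
- apply: (closure_sub_frobenius (r := 0) noethR charR ideal_a ideal_I t_gt0) fI _ => //.
  by move=> N; rewrite addn0 -If.
have [I1|nI1] := EM (I 1).
  have powI m : ideal_pow I m = setT.
    by apply: ideal_full; [exact: pow_ideal | rewrite -(expr1n _ m); exact: pow_in].
  split=> [m|m _] x _.
    exists 1; first exact: circ1.
    by exists 0%N => e _ z _; rewrite powI; exact: frobenius_powT.
  by exists 0%N => e _ z _; rewrite powI; exact: frobenius_powT.
have Imm := proper_sub_max noethR localR ideal_I nI1.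
(* In dimension zero, [mm] is a minimal prime and contains [I]. *)
have n_gt0 : (0 < n)%N.
  case: n dimR => // -[_ dimR]; case: (height_I mm _ Imm).
  split; first exact: max_prime noethR localR.
  move=> Q pQ _; apply: (dim0_max noethR localR (Q := [set 0]) _ pQ).
    by move=> k P /dimR.
  by move=> _ ->; apply: ideal0; case: pQ.
have [|s [g [r [sn gf fg]]]] :=
  reduction_exists noethR localR inf_residue (f := f) dimR.
  by move=> j; apply/Imm/fI; apply: sub_ideal_gen; exists j.
have gI : ideal_gen (range g) `<=` I by rewrite If.
have Ig N : ideal_pow I (N + r) `<=` ideal_pow (ideal_gen (range g)) N by rewrite If.
split=> m; last first.
  by move=> m_gt0; apply: (closure_sub_frobenius noethR charR) sn m_gt0 gI Ig.
have [c cR Ic] := pow_meets_circ noethR r ideal_I height_I.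
apply: (closure_sub_tight charR sn n_gt0 gI cR) => N z Iz.
by apply: Ig; rewrite addnC; exact: powD_in.
Qed.
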